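(* Assume all of the following. (1) $\{\alpha_t\}_{t\ge 0}$ is a decreasing sequence of positive reals with $\sum_t\alpha_t=\infty$, $\sum_t\alpha_t^2<\infty$, and $\lim_{t\to\infty}\left(\frac1{\alpha_{t+1}}-\frac1{\alpha_t}\right)<\infty$ (the limit exists and is finite). (2) The chain $\{S_t\}$ has a unique stationary distribution $\mu$, and $\mu(U)>0$ for every non-empty (relatively) open $U\subseteq\mathcal S$. (3) $\sup_{s\in\mathcal S}\|x(s)\|<\infty$ and $\sup_{s\in\mathcal S}|r(s)|<\infty$. (4) For every measurable $f:\mathcal S\to\mathbb R^n$ with $f=0$ $\mu$-a.e., also $P_\pi f=0$ $\mu$-a.e. (5) (Poisson equation) For each $w\in\mathbb R^d$ there is a measurable function $\nu_w:\mathcal Y\to\mathbb R^d$ with $\nu_w(y)-(P_{\mathcal Y}\nu_w)(y)=H(w,y)-h(w)$ for all $w\in\mathbb{R}^d,y\in\mathcal{Y}$, and there is a constant $C$ such that for all $w,w'\in\mathbb R^d$, $y\in\mathcal Y$: $\|\nu_w(y)\|\le C(1+\|w\|)(1+\|y\|)$ and $\|(P_{\mathcal Y}\nu_w)(y)-(P_{\mathcal Y}\nu_{w'})(y)\|\le C\|w-w'\|(1+\|y\|)$. (6) (Law of iterated logarithm) For each $w\in\mathbb R^d$ there is an almost surely finite random variable $\zeta$ such that almost surely $\left\|\sum_{t=1}^n\left(H(w,Y_t)-h(w)\right)\right\|\le\zeta\sqrt{n\log\log n}$ for all $n\ge 3$. (7) $\mathcal S$ is compact. Then, almost surely, there exists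 at least one convergent subsequence $\{w_{t_k}\}$ of the linear TD iterates $\{w_t\}$, whose limit $w_*$ (possibly sample-path dependent) lies in $\mathcal W_*$, such that for every $T\in(0,\infty)$, $$\lim_{k\to\infty}\ \max_{t_k\le j\le m(t_k,T)}\|w_j-w_*\|=0.$$
   Context: Setting: $K,d\in\mathbb N$; $\mathcal S\subseteq\mathbb R^K$ with its Borel $\sigma$-algebra; $p(\cdot\mid s)$ is a Markov transition kernel on $\mathcal S$; $\{S_t\}_{t\ge0}$ is a Markov chain with kernel $p$ and arbitrary initial distribution; $r:\mathcal S\to\mathbb R$ is a measurable reward function; $\gamma\in[0,1)$; $x:\mathcal S\to\mathbb R^d$ is a measurable feature map (no linear independence is assumed). $\|\cdot\|$ is the Euclidean norm. $(P_\pi f)(s)=\int_{\mathcal S}f(s')\,p(ds'\mid s)$. A stationary distribution is a probability measure $\mu$ on $\mathcal S$ with $\mu(Z)=\int_{\mathcal S}p(Z\mid s)\mu(ds)$ for all Borel $Z$. Linear TD: from an arbitrary $w_0\in\mathbb R^d$, with $R_{t+1}=r(S_t)$, $$w_{t+1}=w_t+\alpha_t\left(R_{t+1}+\gamma x(S_{t+1})^\top w_t-x(S_t)^\top w_t\right)x(S_t).$$ $A=\int_{\mathcal S}x(s)\left(\gamma(P_\pi x)(s)^\top-x(s)^\top\right)\mu(ds)\in\mathbb R^{d\times d}$, $b=\int_{\mathcal S}x(s)r(s)\mu(ds)\in\mathbb R^d$, $\mathcal W_*=\{w\in\mathbb R^d: Aw+b=0\}$. $m(t,T)=\max\{n : \sum_{i=t}^n\alpha_i\le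 T\}$ (for fixed $T>0$ this is $\ge t$ for all large $t$, since $\alpha_t\to0$). Pair chain: $Y_t=(S_t,S_{t+1})$ is a Markov chain evolving in a measurable set $\mathcal Y\subseteq\mathcal S\times\mathcal S\subset\mathbb R^{2K}$, with transition kernel $P_{\mathcal Y}$ (from $(s,s')$ it moves to $(s',s'')$ with $s''\sim p(\cdot\mid s')$) and unique stationary distribution $\eta(ds,ds')=\mu(ds)p(ds'\mid s)$; $(P_{\mathcal Y}f)(y)=\int_{\mathcal Y}f(y')P_{\mathcal Y}(dy'\mid y)$. For $y=(s,s')$, $H(w,y)=\left(r(s)+\gamma w^\top x(s')-w^\top x(s)\right)x(s)$ and $h(w)=\mathbb E_{y\sim\eta}[H(w,y)]=Aw+b$. *)

(* Defs.v *)
From HB Require Import structures.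
From mathcomp Require Import all_boot all_order all_algebra.
From mathcomp Require Import all_classical all_reals all_analysis.
From mathcomp Require Import measurable_realfun.

Set Implicit Arguments.
Unset Strict Implicit.
Unset Printing Implicit Defensive.

Import Order.TTheory GRing.Theory Num.Theory.
Import numFieldNormedType.Exports.

Local Open Scope classical_set_scope.
Local Open Scope ring_scope.

(* A nonempty subset of a topological space as a type of its own, with the
   relative topology and its Borel sigma-algebra.  The nonemptiness proof is
   there because library measurable types are pointed. *)
Definition state {X : topologicalType} {S : set X} (S0 : S !=set0) : Type :=
  set_type S.

Section state_instances.
Context {X : topologicalType} {S : set X} (S0 : S !=set0).

Lemma state_inhabited : exists s : state S0, True.
Proof. by case: S0 => s Ss; exists (exist _ s (mem_set Ss)). Qed.

HB.instance Definition _ := Topological.copy (state S0) (set_type S).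
HB.instance Definition _ :=
  isPointed.Build (state S0) (projT1 (cid state_inhabited)).
HB.instance Definition _ := @isMeasurable.Build (sigma_display (@open (state S0)))
  (state S0) <<s @open (state S0) >>
  (@sigma_algebra0 _ setT _) (@sigma_algebraC _ _)
  (@sigma_algebra_bigcup _ setT _).

End state_instances.

Section euclidean.
Context {R : realType}.

(* The norm of the library on matrices is the sup norm. *)
Definition enorm n (v : 'cV[R]_n) : R := Num.sqrt (\sum_i v i 0 ^+ 2).

Definition dot n (u v : 'cV[R]_n) : R := (u^T *m v) 0 0.

Definition borel_fun d (T : measurableType d) n (D : set T)
    (f : T -> 'cV[R]_n) : Prop :=
  measurable_fun D (f : T -> g_sigma_algebraType (@open 'cV[R]_n)).

Definition mxintegral d (T : measurableType d) (mu : {measure set T -> \bar R})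
    (D : set T) m n (F : T -> 'M[R]_(m, n)) : 'M[R]_(m, n) :=
  \matrix_(i, j) \int[mu]_(s in D) F s i j.

End euclidean.

Section markov.
Context {R : realType} d (T : measurableType d) (p : R.-pker T ~> T).

Definition stationary (mu : set T -> \bar R) : Prop :=
  forall Z, measurable Z -> mu Z = (\int[mu]_s p s Z)%E.

Definition unique_stationary (mu : probability T R) : Prop :=
  stationary mu /\
  forall mu' : probability T R, stationary mu' ->
    forall Z, measurable Z -> mu' Z = mu Z.

Definition history d' (Omega : measurableType d') (X : nat -> Omega -> T)
    (t : nat) : set (set Omega) :=
  <<s \bigcup_(i in [set i | (i <= t)%N])
        preimage_set_system setT (X i) measurable >>.

(* P (X_(t+1) \in B | X_0, ..., X_t) = p (B | X_t) almost surely, in integrated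
   form; the law of X_0 is unconstrained. *)
Definition markov_chain d' (Omega : measurableType d') (P : probability Omega R)
    (X : nat -> Omega -> T) : Prop :=
  forall t E B, history X t E -> measurable B ->
    P (E `&` X t.+1 @^-1` B) = (\int[P]_(omega in E) p (X t omega) B)%E.

Definition kernel_app n (f : T -> 'cV[R]_n) (s : T) : 'cV[R]_n :=
  mxintegral (p s) setT f.

(* (s, s') moves to (s', s'') with s'' ~ p (. | s') *)
Definition pair_kernel (y : T * T) : set (T * T) -> \bar R :=
  pushforward (p y.2) (pair y.2).

Let measurable_pair_fst (s : T) : measurable_fun setT (pair s : T -> T * T).
Proof. exact: measurable_pair1. Qed.

Let pair_kernel0 y : pair_kernel y set0 = 0%E.
Proof. by rewrite /pair_kernel /pushforward preimage_set0 measure0. Qed.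

Let pair_kernel_ge0 y A : (0 <= pair_kernel y A)%E.
Proof. exact: measure_ge0. Qed.

Let pair_kernel_sigma_additive y : semi_sigma_additive (pair_kernel y).
Proof.
move=> F mF tF mUF; rewrite /pair_kernel /pushforward preimage_bigcup.
have mpre A : measurable A -> measurable (pair y.2 @^-1` A : set T).
  by move=> mA; rewrite -[X in measurable X]setTI; exact: measurable_pair_fst.
apply: measure_semi_sigma_additive.
- by move=> n; exact: mpre.
- apply/trivIsetP => /= i j _ _ ij; rewrite -preimage_setI.
  by move/trivIsetP : tF => /(_ _ _ _ _ ij) ->//; rewrite preimage_set0.
- by rewrite -preimage_bigcup; exact: mpre.
Qed.

HB.instance Definition _ y := isMeasure.Build _ _ _ (pair_kernel y)
  (pair_kernel0 y) (pair_kernel_ge0 y) (@pair_kernel_sigma_additive y).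

Definition pair_kernel_app (Y : set (T * T)) n (f : T * T -> 'cV[R]_n)
    (y : T * T) : 'cV[R]_n :=
  mxintegral (pair_kernel y) Y f.

End markov.

Section pair_law.
Context {R : realType} d (T : measurableType d) (p : R.-pker T ~> T).
Variable mu : {measure set T -> \bar R}.

(* the measure mu(ds) p(ds'|s) *)
Definition pair_law (Z : set (T * T)) : \bar R :=
  (\int[mu]_s p s (xsection Z s))%E.

Let pair_law0 : pair_law set0 = 0%E.
Proof. by rewrite [LHS]integral0_eq// => s _; rewrite xsection0. Qed.

Let pair_law_ge0 Z : (0 <= pair_law Z)%E.
Proof. by apply: integral_ge0. Qed.

Let pair_law_sigma_additive : semi_sigma_additive pair_law.
Proof.
move=> F mF tF mUF.
rewrite [X in _ --> X](_ : _ = \sum_(n <oo) pair_law (F n))%E.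
  by apply/cvg_closeP; split; [exact: is_cvg_nneseries|rewrite closeE].
rewrite -integral_nneseries//; last first.
  by move=> n; apply: measurable_fun_xsection_finite_kernel; rewrite inE.
apply: eq_integral => x _; apply/esym/cvg_lim => //=; rewrite xsection_bigcup.
apply: (measure_sigma_additive _ (trivIset_xsection tF)) => ?.
exact: measurable_xsection.
Qed.

HB.instance Definition _ := isMeasure.Build _ _ _ pair_law
  pair_law0 pair_law_ge0 pair_law_sigma_additive.

End pair_law.

Section linear_td.
Context {R : realType} {d : measure_display} {T : measurableType d} {n : nat}.
Variables (p : R.-pker T ~> T) (mu : {measure set T -> \bar R}).
Variables (r : T -> R) (gamma : R) (x : T -> 'cV[R]_n).

Definition td_A : 'M[R]_n :=
  mxintegral mu setT
    (fun s => x s *m (gamma *: (kernel_app p x s)^T - (x s)^T)).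

Definition td_b : 'cV[R]_n := mxintegral mu setT (fun s => r s *: x s).

Definition td_solutions : set 'cV[R]_n := [set w | td_A *m w + td_b = 0].

Definition td_H (w : 'cV[R]_n) (y : T * T) : 'cV[R]_n :=
  (r y.1 + gamma * dot w (x y.2) - dot w (x y.1)) *: x y.1.

Definition td_h (w : 'cV[R]_n) : 'cV[R]_n :=
  mxintegral (pair_law p mu) setT (td_H w).

(* the iterates along one realization S of the chain *)
Fixpoint td_iter (alpha : nat -> R) (w0 : 'cV[R]_n) (S : nat -> T) (t : nat)
    : 'cV[R]_n :=
  if t is t'.+1 then
    let w := td_iter alpha w0 S t' in
    w + (alpha t' *
         (r (S t') + gamma * dot (x (S t'.+1)) w - dot (x (S t')) w)) *: x (S t')
  else w0.

End linear_td.

(* max {n | alpha_t + ... + alpha_n <= T}.  Empty sums count, so for t > 0 the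
   value is smaller than t when alpha_t > T; 0 is a junk value, taken only when
   there is no maximum. *)
Definition horizon {R : realType} (alpha : nat -> R) (t : nat) (T : R) : nat :=
  let A := [set n | \sum_(t <= i < n.+1) alpha i <= T] in
  xget 0%N [set n | A n /\ ubound A n].

(* Main.v *)
Require Import Defs.
From HB Require Import structures.
From mathcomp Require Import all_boot all_order all_algebra.
From mathcomp Require Import all_classical all_reals all_analysis.
From mathcomp Require Import measurable_realfun.
From mathcomp Require Import ring lra.

Set Implicit Arguments.
Unset Strict Implicit.
Unset Printing Implicit Defensive.

Import Order.TTheory GRing.Theory Num.Theory.
Import numFieldNormedType.Exports.

Local Open Scope classical_set_scope.
Local Open Scope ring_scope.

(* Stationarity gives [z . A z <= - c |A z|^2]; in particular [A^T z = 0] forces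
   [x(s) . z = 0] almost everywhere, hence [b . z = 0], so some [wbar] solves
   [A wbar + b = 0].  The column [u = (w - wbar, 1)] obeys a homogeneous linear
   recursion, and the Poisson equation splits its random matrix into [A], a
   bounded martingale difference and a telescoping term.  The Lyapunov function
   [E |u|^2] corrected by the telescoping term then yields [sup E |u_t|^2 < oo]
   and [sum alpha_t E |A u_t|^2 < oo].

   Consequently the martingale part of [u] converges almost surely by
   Kolmogorov's maximal inequality, and the telescoping part by summation by
   parts.  On a window of step mass [T] the drift is at most
   [sqrt (T * sum_(i >= t) alpha_i |A u_i|^2)], which tends to [0].  Finally, along
   a deterministic subsequence [sum_k E |A u_(t_k)|^2 < oo], and Fatou's lemma
   makes [u] bounded infinitely often along it, so a further subsequence converges
   to a zero of [A]. *)

(** * Bounded measurable functions and disintegration *)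

(** The features may be linearly dependent, so [A] may be singular: no contraction towards the
    solution set is available, and nothing bounds the iterates in advance. Dissipativity in the form
    [c * |A z|^2 <= - z . A z] survives, because both sides compare with the same quantity, the mean
    of [(z . x)^2] under [mu]. Homogeneity matters since every error is then proportional to
    [|u|^2], so that the second-moment bound can be bootstrapped from a late starting time without
    any prior bound. As [td_H] is affine in [w], the Poisson solutions at [wbar] and at its
    translates by basis vectors suffice, and compactness bounds each of these finitely many
    functions. The drift estimate only gives the sum of [E |A u_t|^2] weighted by step sizes, so a
    zero of [A] is reached along sparse times, and the window estimate carries the limit forward
    from each of them. *)

Section bounded_measurable.
Context {R : realType} {d : measure_display} {T : measurableType d}.
Implicit Types f g : T -> R.

(** At each fixed time the random quantities of the proof are bounded. This class is closed under
    sums and products and lies in every integrable class of a measure of mass one, so integrability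
    needs no separate argument. *)
Definition bmf f := measurable_fun setT f /\ exists C, forall x, `|f x| <= C.

Lemma bmf_cst (c : R) : bmf (fun _ => c).
Proof. by split; [exact: measurable_cst|exists `|c|]. Qed.

Lemma bmfD f g : bmf f -> bmf g -> bmf (fun x => f x + g x).
Proof.
move=> [mf [C fC]] [mg [D gD]]; split; first exact: measurable_funD.
by exists (C + D) => x; rewrite (le_trans (ler_normD _ _))// lerD.
Qed.

Lemma bmfN f : bmf f -> bmf (fun x => - f x).
Proof.
move=> [mf [C fC]]; split; first exact: measurableT_comp.
by exists C => x; rewrite normrN.
Qed.

Lemma bmfB f g : bmf f -> bmf g -> bmf (fun x => f x - g x).
Proof. by move=> bf bg; apply: bmfD => //; exact: bmfN. Qed.

Lemma bmfM f g : bmf f -> bmf g -> bmf (fun x => f x * g x).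
Proof.
move=> [mf [C fC]] [mg [D gD]]; split; first exact: measurable_funM.
by exists (C * D) => x; rewrite normrM ler_pM.
Qed.

Lemma bmfZ (c : R) f : bmf f -> bmf (fun x => c * f x).
Proof. by move=> bf; apply: bmfM => //; exact: bmf_cst. Qed.

Lemma bmf_sqr f : bmf f -> bmf (fun x => f x ^+ 2).
Proof. by move=> bf; under eq_fun do rewrite expr2; exact: bmfM. Qed.

Lemma bmf_sum (I : Type) (s : seq I) (Q : pred I) (F : I -> T -> R) :
  (forall i, bmf (F i)) -> bmf (fun x => \sum_(i <- s | Q i) F i x).
Proof.
move=> bF; elim: s => [|i s IH].
  by under eq_fun do rewrite big_nil; exact: bmf_cst.
under eq_fun do rewrite big_cons.
by case: (Q i) => //; apply: bmfD.
Qed.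

Variable m : {measure set T -> \bar R}.
Hypothesis m1 : m setT = 1%E.

(** Mass one is a plain hypothesis on a measure, so that the same lemmas serve [P], [mu], the kernel
    measures [p s] and [pair_law p mu]. *)
Lemma bmf_integrable f : bmf f -> m.-integrable setT (EFin \o f).
Proof.
move=> [mf [C fC]]; apply: measurable_bounded_integrable => //.
  by rewrite m1 ltry.
exists C; split => [|M CM x _]; first exact: num_real.
by apply: le_trans (fC x) _; exact: ltW.
Qed.

Lemma bmf_EFin f : bmf f -> (\int[m]_x (f x)%:E)%E = (\int[m]_x f x)%:E.
Proof.
move=> bf; rewrite fineK//; apply: integrable_fin_num => //.
exact: bmf_integrable.
Qed.

Lemma bmf_intD f g : bmf f -> bmf g ->
  \int[m]_x (f x + g x) = \int[m]_x f x + \int[m]_x g x.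
Proof. by move=> bf bg; apply: RintegralD => //; exact: bmf_integrable. Qed.

Lemma bmf_intB f g : bmf f -> bmf g ->
  \int[m]_x (f x - g x) = \int[m]_x f x - \int[m]_x g x.
Proof. by move=> bf bg; apply: RintegralB => //; exact: bmf_integrable. Qed.

Lemma bmf_intZ (c : R) f : bmf f ->
  \int[m]_x (c * f x) = c * \int[m]_x f x.
Proof. by move=> bf; apply: RintegralZl => //; exact: bmf_integrable. Qed.

Lemma bmf_int_cst (c : R) : \int[m]_x c = c.
Proof. by rewrite Rintegral_cst// m1 mulr1. Qed.

Lemma bmf_int_sum (I : Type) (s : seq I) (Q : pred I) (F : I -> T -> R) :
  (forall i, bmf (F i)) ->
  \int[m]_x (\sum_(i <- s | Q i) F i x) = \sum_(i <- s | Q i) \int[m]_x F i x.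
Proof.
move=> bF; elim: s => [|i s IH].
  by under eq_Rintegral do rewrite big_nil; rewrite bmf_int_cst big_nil.
under eq_Rintegral do rewrite big_cons.
rewrite big_cons; case: (Q i) => //; rewrite bmf_intD ?IH//.
exact: bmf_sum.
Qed.

Lemma bmf_int_le f g : bmf f -> bmf g -> (forall x, f x <= g x) ->
  \int[m]_x f x <= \int[m]_x g x.
Proof.
by move=> bf bg fg; apply: le_Rintegral => //; exact: bmf_integrable.
Qed.

Lemma bmf_int_norm f C : bmf f -> (forall x, `|f x| <= C) ->
  `|\int[m]_x f x| <= C.
Proof.
move=> bf fC; have CC x : - C <= f x <= C by rewrite -ler_norml.
rewrite ler_norml -[X in X <= _]bmf_int_cst -[X in _ && (_ <= X)]bmf_int_cst.
apply/andP; split; apply: bmf_int_le => //; try exact: bmf_cst;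
  by move=> x; case/andP: (CC x).
Qed.

(** The variance of [f] is nonnegative. *)
Lemma sqr_int_le f : bmf f -> (\int[m]_x f x) ^+ 2 <= \int[m]_x (f x ^+ 2).
Proof.
move=> bf; set c := \int[m]_x f x.
have : 0 <= \int[m]_x (f x ^+ 2 - (2 * c) * f x + c ^+ 2).
  apply: Rintegral_ge0 => x _.
  by rewrite [leRHS](_ : _ = (f x - c) ^+ 2) ?sqr_ge0//; ring.
have b1 := bmf_sqr bf.
have b2 := bmfZ (2 * c) bf.
rewrite bmf_intD ?bmf_intB// ?bmf_int_cst ?bmf_intZ//; last 2 first.
- exact: bmfB.
- exact: bmf_cst.
rewrite -/c => H; rewrite -subr_ge0.
by rewrite (le_trans H)// le_eqVlt; apply/orP; left; apply/eqP; ring.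
Qed.

End bounded_measurable.

Lemma bmf_comp {R : realType} d d' (T : measurableType d)
    (T' : measurableType d') (f : T' -> R) (g : T -> T') :
  bmf f -> measurable_fun setT g -> bmf (f \o g).
Proof.
move=> [mf [C fC]] mg; split; first exact: measurableT_comp.
by exists C => x; exact: fC.
Qed.

(** * Composed kernels and disintegration of a measure on a product *)

Section comap_kernel.
Context {R : realType} d1 d2 d3 (T1 : measurableType d1)
  (T2 : measurableType d2) (T3 : measurableType d3).
Variables (p : R.-pker T2 ~> T3) (f : T1 -> T2).

Definition comap_kernel (_ : measurable_fun setT f) (x : T1) :
  {measure set T3 -> \bar R} := p (f x).

Hypothesis mf : measurable_fun setT f.

Let measurable_comap_kernel U : measurable U ->
  measurable_fun setT (comap_kernel mf ^~ U).
Proof.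
by move=> mU; exact: (measurableT_comp (measurable_kernel p U mU) mf).
Qed.

HB.instance Definition _ := isKernel.Build _ _ _ _ _ (comap_kernel mf)
  measurable_comap_kernel.

Let comap_kernel1 x : comap_kernel mf x setT = 1%E.
Proof. exact: prob_kernel. Qed.

HB.instance Definition _ := Kernel_isProbability.Build _ _ _ _ _
  (comap_kernel mf) comap_kernel1.

End comap_kernel.

(* The dummy [unit] is the parameter expected by [kcomp]. *)
Section graph_kernel.
Context {R : realType} d1 d2 (T1 : measurableType d1) (T2 : measurableType d2).
Variable k : R.-pker T1 ~> T2.

Let mpair (x : T1) : measurable_fun setT (pair x : T2 -> T1 * T2).
Proof. exact: pair1_measurable. Qed.

Definition graph_kernel (x : unit * T1) : set (T1 * T2) -> \bar R :=
  pushforward (k x.2) (pair x.2).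

Let mpre x (A : set (T1 * T2)) : measurable A -> measurable (pair x @^-1` A : set T2).
Proof. by move=> mA; rewrite -[X in measurable X]setTI; exact: mpair. Qed.

Let graph_kernel0 x : graph_kernel x set0 = 0%E.
Proof. by rewrite /graph_kernel /pushforward preimage_set0 measure0. Qed.

Let graph_kernel_ge0 x A : (0 <= graph_kernel x A)%E.
Proof. exact: measure_ge0. Qed.

Let graph_kernel_sigma_additive x : semi_sigma_additive (graph_kernel x).
Proof.
move=> F mF tF mUF; rewrite /graph_kernel /pushforward preimage_bigcup.
apply: measure_semi_sigma_additive.
- by move=> n; exact: mpre.
- apply/trivIsetP => /= i j _ _ ij; rewrite -preimage_setI.
  by move/trivIsetP : tF => /(_ _ _ _ _ ij) ->//; rewrite preimage_set0.
- by rewrite -preimage_bigcup; exact: mpre.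
Qed.

HB.instance Definition _ x := isMeasure.Build _ _ _ (graph_kernel x)
  (graph_kernel0 x) (graph_kernel_ge0 x) (@graph_kernel_sigma_additive x).

Definition mgraph_kernel : unit * T1 -> {measure set (T1 * T2) -> \bar R} :=
  graph_kernel.

Let measurable_graph_kernel U : measurable U ->
  measurable_fun setT (mgraph_kernel ^~ U).
Proof.
move=> mU; rewrite (_ : _ ^~ U = (fun x => k x (xsection U x)) \o snd); last first.
  apply/funext => -[u x] /=.
  by rewrite /mgraph_kernel/= /graph_kernel /pushforward/= xsectionE.
apply: measurableT_comp => //.
by apply: measurable_fun_xsection_finite_kernel; rewrite inE.
Qed.

HB.instance Definition _ := isKernel.Build _ _ _ _ _ mgraph_kernel
  measurable_graph_kernel.

Let graph_kernel1 x : mgraph_kernel x setT = 1%E.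
Proof.
by rewrite /mgraph_kernel/= /graph_kernel /pushforward preimage_setT prob_kernel.
Qed.

HB.instance Definition _ := Kernel_isProbability.Build _ _ _ _ _
  mgraph_kernel graph_kernel1.

End graph_kernel.

Section disintegration.
Context {R : realType} d1 d2 (T1 : measurableType d1) (T2 : measurableType d2).
Variables (k : R.-pker T1 ~> T2) (m : probability T1 R).
Variable M : {measure set (T1 * T2) -> \bar R}.
Hypothesis M_rect : forall A B, measurable A -> measurable B ->
  M (A `*` B) = (\int[m]_(x in A) k x B)%E.

(** Rectangles form a generating family closed under intersection, so [M_rect] identifies [M] with
    the law of a pair whose first entry is drawn from [m] and whose second is drawn from [k]. That
    law is a composed kernel, for which the iterated integral is known. *)
Lemma ge0_disintegration (G : T1 * T2 -> \bar R) :
  (forall z, (0 <= G z)%E) -> measurable_fun setT G ->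
  (\int[M]_z G z = \int[m]_x \int[k x]_y G (x, y))%E.
Proof.
move=> G0 mG.
pose l : R.-pker unit ~> T1 :=
  kprobability (@measurable_cst _ _ unit _ setT (m : pprobability T1 R)).
pose N := kcomp l (mgraph_kernel k) tt.
have MN C : measurable C -> M C = N C.
  apply: (measure_unique [set A `*` B | A in measurable & B in measurable]
    (fun=> setT)) => //.
  - by rewrite measurable_prod_measurableType.
  - move=> _ _ [X1 mX1 [X2 mX2 <-]] [Y1 mY1 [Y2 mY2 <-]].
    exists (X1 `&` Y1); first exact: measurableI.
    by exists (X2 `&` Y2); [exact: measurableI|rewrite setXI].
  - by move=> _; exists setT => //; exists setT => //; rewrite setXTT.
  - by apply/seteqP; split => // x _; exists 0%N.
  - move=> _ [A mA [B mB <-]]; rewrite M_rect// integral_mkcond.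
    apply: eq_integral => x _; rewrite patchE /= /mgraph_kernel /= /graph_kernel.
    rewrite /pushforward /= -xsectionE; case: ifPn => xA.
      by rewrite in_xsectionX.
    by rewrite notin_xsectionX// measure0.
  - move=> _; rewrite -setXTT M_rect//.
    under eq_integral do rewrite prob_kernel.
    by rewrite integral_cst// mul1e [X in (X < _)%E](probability_setT m) ltry.
rewrite (eq_measure_integral N) => [|A mA _]; last exact: MN.
rewrite integral_kcomp//; apply: eq_integral => x _ /=.
by rewrite /mgraph_kernel/= ge0_integral_pushforward.
Qed.

Lemma disintegration1 : M setT = 1%E.
Proof.
rewrite -setXTT M_rect//; under eq_integral do rewrite prob_kernel.
by rewrite integral_cst// mul1e [X in X = _](probability_setT m).
Qed.

Lemma bmf_kernel_int (G : T1 * T2 -> R) : bmf G ->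
  bmf (fun x => \int[k x]_y G (x, y)).
Proof.
move=> bG; have bGx x : bmf (fun y => G (x, y)).
  by apply: (bmf_comp bG); exact: pair1_measurable.
have [mG [C GC]] := bG.
split; last first.
  by exists C => x; apply: bmf_int_norm => //; exact: prob_kernel.
have H (H : T1 * T2 -> R) : bmf H -> (forall z, 0 <= H z) ->
    measurable_fun setT (fun x => \int[k x]_y H (x, y)).
  move=> [mH _] H0; apply: measurableT_comp => //.
  apply: (measurable_fun_integral_finite_kernel (EFin \o H)) => //.
  exact/measurable_EFinP.
have bGC : bmf (fun z => G z + C) by apply: bmfD => //; exact: bmf_cst.
(* Shifting by the bound [C] makes the integrand nonnegative, the case already settled; mass one
   lets the constant be removed afterwards. *)
rewrite (_ : (fun x => _) = (fun x => \int[k x]_y (G (x, y) + C) - C)).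
  apply: measurable_funB => //; apply: (H _ bGC) => z.
  by rewrite -lerBlDr sub0r; move: (GC z); rewrite ler_norml => /andP[].
apply/funext => x; rewrite bmf_intD ?bmf_int_cst ?addrK//.
- exact: prob_kernel.
- exact: prob_kernel.
- exact: bmf_cst.
Qed.

Lemma disintegration (G : T1 * T2 -> R) : bmf G ->
  \int[M]_z G z = \int[m]_x \int[k x]_y G (x, y).
Proof.
move=> bG; have [mG [C GC]] := bG.
have bC d (T : measurableType d) : bmf (fun _ : T => C) by exact: bmf_cst.
have bGC : bmf (fun z => G z + C) by exact: bmfD.
have bGx x : bmf (fun y => G (x, y)).
  by apply: (bmf_comp bG); exact: pair1_measurable.
have bGCx x : bmf (fun y => G (x, y) + C) by exact: bmfD.
have bkG := bmf_kernel_int bG.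
have k1 x : k x setT = 1%E by exact: prob_kernel.
have m1 : m setT = 1%E by exact: probability_setT.
apply: (@addIr _ C).
rewrite -[X in _ + X = _](bmf_int_cst disintegration1).
rewrite -[X in _ = _ + X](bmf_int_cst m1) -!bmf_intD//; last exact: disintegration1.
rewrite /Rintegral ge0_disintegration//; last 2 first.
- move=> z; rewrite lee_fin -lerBlDr sub0r.
  by move: (GC z); rewrite ler_norml => /andP[].
- by apply/measurable_EFinP; case: bGC.
congr fine; apply: eq_integral => x _.
rewrite bmf_EFin// bmf_intD// bmf_int_cst//.
Qed.

End disintegration.

Lemma bmf_int_distribution {R : realType} d d' (T : measurableType d)
    (T' : measurableType d') (P : probability T R) (X : {mfun T >-> T'})
    (f : T' -> R) : bmf f ->
  \int[distribution P X]_y f y = \int[P]_x f (X x).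
Proof.
move=> bf; congr fine; apply: integral_distribution.
  by apply/measurable_EFinP; case: bf.
apply: bmf_integrable; first exact: probability_setT.
exact: bmf_comp.
Qed.

(** * Sub-sigma-algebras and the Markov property for expectations *)

Section sub_sigma_algebra.
Context {R : realType} d (T : measurableType d).
Variables (G : set (set T)) (GT : G `<=` measurable).

(** Measurability for a smaller sigma-algebra is expressed by retyping the domain, so all closure
    properties of measurable functions apply as they stand. *)
Definition smeas d' (T' : measurableType d') (f : T -> T') : Prop :=
  measurable_fun setT (f : g_sigma_algebraType G -> T').

Lemma measurable_sub_id :
  measurable_fun setT (id : T -> g_sigma_algebraType G).
Proof.
move=> _ A mA; rewrite setTI preimage_id.
by move: A mA; apply: smallest_sub => //; exact: sigma_algebra_measurable.
Qed.

Lemma smeasW d' (T' : measurableType d') (f : T -> T') :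
  smeas f -> measurable_fun setT f.
Proof. by move=> mf; exact: (measurableT_comp mf measurable_sub_id). Qed.

End sub_sigma_algebra.

Lemma smeasS d d' (T : measurableType d) (T' : measurableType d')
    (G G' : set (set T)) (f : T -> T') : G `<=` G' -> smeas G f -> smeas G' f.
Proof.
move=> GG' mf _ A mA; rewrite setTI.
have := mf measurableT A mA; rewrite setTI.
by apply: sub_smallest2r => //; exact: smallest_sigma_algebra.
Qed.

Section markov_expectation.
Context {R : realType} d (T : measurableType d) (p : R.-pker T ~> T).
Context d' (Omega : measurableType d') (P : probability Omega R).
Variables (X : nat -> {RV P >-> T}).

(** The generators of [history]; only generators are carried along, because [smeas] generates the
    sigma-algebra itself. *)
Definition history_gen (t : nat) : set (set Omega) :=
  \bigcup_(i in [set i | (i <= t)%N]) preimage_set_system setT (X i) measurable.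

Lemma history_gen_measurable t : history_gen t `<=` measurable.
Proof. by move=> _ [i _ [B mB <-]]; exact: measurable_funPT. Qed.

Lemma history_gen_le s t : (s <= t)%N -> history_gen s `<=` history_gen t.
Proof.
by move=> st A [i /= ilt XA]; exists i => //=; exact: leq_trans st.
Qed.

Lemma smeas_history s t : (s <= t)%N -> smeas (history_gen t) (X s).
Proof.
move=> st _ A mA; apply: sub_sigma_algebra; exists s => //.
by exists A => //; rewrite setTI.
Qed.

(** Conditional centring at time [t]. The pair of the sample point, seen only through the history up
    to [t], and [X t.+1] has a law for which [markov_chain] is exactly the rectangle identity of the
    disintegration. The factor [F] depends on the first entry alone and leaves the inner
    integral. *)
Lemma markov_expectation (t : nat) (F : Omega -> R) (f : T * T -> R) :
    markov_chain p P X -> bmf F -> smeas (history_gen t) F -> bmf f ->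
  \int[P]_omega (F omega * (f (X t omega, X t.+1 omega)
    - \int[p (X t omega)]_s f (X t omega, s))) = 0.
Proof.
move=> XM bF sF bf.
set G := history_gen t; have GT : G `<=` measurable := @history_gen_measurable t.
pose Ot := g_sigma_algebraType G.
pose mid := isMeasurableFun.Build _ _ _ _ _ (measurable_sub_id GT).
pose idt : {mfun Omega >-> Ot} := MeasurableFun.Pack (MeasurableFun.Class mid).
pose m := distribution P idt.
have mXt : measurable_fun setT (X t : Ot -> T) by exact: smeas_history.
pose k := comap_kernel p mXt.
have mpr : measurable_fun setT (fun w : Omega => (w : Ot, X t.+1 w)).
  by apply: measurable_fun_pair => //; exact: measurable_sub_id.
pose mpr' := isMeasurableFun.Build _ _ _ _ _ mpr.
pose pr : {mfun Omega >-> (Ot * T)%type} :=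
  MeasurableFun.Pack (MeasurableFun.Class mpr').
have Mrect A B : measurable A -> measurable B ->
    distribution P pr (A `*` B) = (\int[m]_(x in A) k x B)%E.
  move=> mA mB; rewrite /m [in RHS]ge0_integral_pushforward//.
    rewrite /distribution /pushforward/=.
    rewrite (_ : _ @^-1` _ = A `&` X t.+1 @^-1` B); last by apply/seteqP; split.
    by rewrite XM.
  apply: measurable_funTS.
  exact: (measurable_kernel k).
have bE : bmf (fun z : Ot * T => F z.1 * f (X t z.1, z.2)).
  apply: bmfM.
    split; last by case: bF => _ [C FC]; exists C => z.
    exact: (measurableT_comp sF).
  apply: (bmf_comp bf); apply: measurable_fun_pair => //.
  exact: (measurableT_comp mXt).
have fX : bmf (fun w : Omega => f (X t w, X t.+1 w)).
  by apply: (bmf_comp bf); exact: measurable_fun_pair.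
have kX : bmf (fun s => \int[p s]_y f (s, y)) by exact: bmf_kernel_int.
have kfX : bmf (fun w : Omega => \int[p (X t w)]_s f (X t w, s)).
  by apply: (bmf_comp kX).
have P1 : P setT = 1%E by exact: probability_setT.
under eq_Rintegral do rewrite mulrBr.
rewrite bmf_intB//; [|exact: bmfM|exact: bmfM].
apply/eqP; rewrite subr_eq0; apply/eqP.
have := disintegration Mrect bE.
rewrite bmf_int_distribution// bmf_int_distribution/=; last first.
  exact: (bmf_kernel_int k bE).
move=> ->; apply: eq_Rintegral => w _ /=.
rewrite bmf_intZ//; first exact: prob_kernel.
apply: (bmf_comp bf).
exact: pair1_measurable.
Qed.

End markov_expectation.

(** * Square-integrable martingales *)

Lemma sum_tail_le {R : realType} (v : nat -> R) (V : R) :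
    (forall t, 0 <= v t) -> (forall n, \sum_(0 <= t < n) v t <= V) ->
  forall eps : R, 0 < eps -> exists m0, forall m n, (m0 <= m)%N ->
    \sum_(m <= t < n) v t <= eps.
Proof.
move=> v0 vV eps e0; pose S n := \sum_(0 <= t < n) v t.
have ndS : {homo S : m n / (m <= n)%N >-> m <= n}.
  move=> m n mn; rewrite /S [leRHS](big_cat_nat (n := m))//= lerDl.
  by apply: sumr_ge0.
have cS : cvgn S.
  by apply: nondecreasing_is_cvgn => //; exists V => _ [n _ <-]; exact: vV.
have [m0 _ Hm0] : \forall n \near \oo, limn S - eps < S n.
  by apply: (cvgr_gt (limn S)) => //; rewrite ltrBlDr ltrDl.
exists m0 => m n m0m; have [nm|mn] := leqP n m; first by rewrite big_geq ?ltW.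
have Sn := nondecreasing_cvgn_le ndS cS n.
have Sm := Hm0 m m0m.
have : S n = S m + \sum_(m <= t < n) v t by rewrite /S (@big_cat_nat _ _ _ m)//= ltnW.
by move=> SE; move: Sn Sm; rewrite SE; lra.
Qed.

Lemma bmf_norm_lt {R : realType} d (T : measurableType d) (f : T -> R) (e : R) :
  bmf f -> bmf (fun x => (`|f x| < e)%R%:R : R).
Proof.
move=> [mf _]; split; last first.
  by exists 1 => x; case: (_ < _) => /=; rewrite ?normr1 ?normr0.
rewrite (_ : (fun x => _) = \1_[set x | (`|f x| < e)%R]); last first.
  apply/funext => x; rewrite indicE; case: (ltP `|f x| e) => fe.
    by rewrite mem_set.
  by rewrite memNset//=; apply/negP; rewrite -leNgt.
apply: measurable_indic.
have mn : measurable_fun setT (fun x => `|f x|) by exact: measurableT_comp.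
have := mn measurableT `]-oo, e[%classic (measurable_itv _); rewrite setTI.
by congr measurable; apply/seteqP; split => x /=; rewrite in_itv.
Qed.

Lemma chebyshev_sqr {R : realType} d (T : measurableType d)
    (P : probability T R) (f : T -> R) (e c : R) : 0 < e -> bmf f ->
  \int[P]_x (f x ^+ 2) <= c ->
  (P [set x | (e <= `|f x|)%R] <= (c / e ^+ 2)%:E)%E.
Proof.
move=> e0 bf fc; set A := [set x | _].
have P1 : P setT = 1%E by exact: probability_setT.
pose I x : R := 1 - (`|f x| < e)%R%:R.
have bI : bmf I by apply: bmfB; [exact: bmf_cst|exact: bmf_norm_lt].
have IE : I = \1_A.
  apply/funext => x; rewrite /I indicE; case: (ltP `|f x| e) => fe.
    by rewrite memNset ?subrr// /A/=; apply/negP; rewrite -ltNge.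
  by rewrite mem_set// subr0.
have mA : measurable A.
  have mn : measurable_fun setT (fun x => `|f x|).
    by apply: measurableT_comp => //; case: bf.
  have := mn measurableT `[e, +oo[%classic (measurable_itv _); rewrite setTI.
  by congr measurable; apply/seteqP; split => x /=; rewrite in_itv /= andbT.
have PA : P A = (\int[P]_x I x)%:E.
  by rewrite -bmf_EFin// IE integral_indic// setIT.
rewrite PA lee_fin ler_pdivlMr ?exprn_gt0// mulrC -bmf_intZ//.
apply: le_trans fc; apply: bmf_int_le => //; [exact: bmfZ|exact: bmf_sqr|].
move=> x; rewrite /I; case: ltP => /= fe; first by rewrite subrr mulr0 sqr_ge0.
by rewrite subr0 mulr1 -[leRHS]real_normK ?num_real// lerXn2r// nnegrE ltW.
Qed.

Section L2_martingale.
Context {R : realType} d (Omega : measurableType d) (P : probability Omega R).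
Variable G : nat -> set (set Omega).
Hypothesis GP : forall t, G t `<=` measurable.
Hypothesis GS : forall t, G t `<=` G t.+1.

Definition sbmf (t : nat) (f : Omega -> R) : Prop :=
  bmf (f : g_sigma_algebraType (G t) -> R).

Lemma sbmfW t f : sbmf t f -> bmf f.
Proof. by move=> [mf fC]; split => //; exact: (smeasW (GP (t:=t))). Qed.

Lemma sbmfS t f : sbmf t f -> sbmf t.+1 f.
Proof. by move=> [mf fC]; split => //; exact: (smeasS (GS (t:=t))). Qed.

(** The increment [xi t] leads from time [t] to [t.+1], hence the shift in measurability.
    Conditional mean zero is encoded as orthogonality to all bounded functions known at time [t]. *)
Definition martingale_diff (xi : nat -> Omega -> R) : Prop :=
  (forall t, sbmf t.+1 (xi t)) /\
  forall t F, sbmf t F -> \int[P]_w (F w * xi t w) = 0.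

Variables (xi : nat -> Omega -> R) (v : nat -> R) (V : R).
Hypothesis xiM : martingale_diff xi.
Hypothesis xi_v : forall t, \int[P]_w (xi t w ^+ 2) <= v t.
Hypothesis v_V : forall n, \sum_(0 <= t < n) v t <= V.

(* Freezing the martingale once it leaves [(-e, e)] turns Chebyshev's inequality
   at one time into a bound on the running maximum. *)
Fixpoint stopped (e : R) (m k : nat) (w : Omega) : R :=
  if k is k'.+1 then
    stopped e m k' w + (`|stopped e m k' w| < e)%R%:R * xi (m + k') w
  else 0.

Let sbmf_stopped e m k : sbmf (m + k) (stopped e m k).
Proof.
elim: k => [|k IH]; first exact: bmf_cst.
have H : sbmf (m + k).+1 (stopped e m k) by exact: sbmfS.
rewrite addnS; apply: (bmfD H); apply: bmfM; first exact: (bmf_norm_lt e H).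
exact: xiM.1.
Qed.

(** The stopped value and its indicator are known at time [m + k], so the cross term in the expanded
    square integrates to zero; the indicator can only decrease the remaining square of [xi]. *)
Let stopped_L2 e m k :
  \int[P]_w (stopped e m k w ^+ 2) <= \sum_(m <= t < m + k) v t.
Proof.
have P1 : P setT = 1%E by exact: probability_setT.
elim: k => [|k IH].
  rewrite addn0 big_geq//; under eq_Rintegral do rewrite /= expr0n/=.
  by rewrite bmf_int_cst.
rewrite addnS big_nat_recr ?leq_addr//=.
set I := fun w => (`|stopped e m k w| < e)%R%:R : R.
have sZ := sbmf_stopped e m k.
have sI : sbmf (m + k) I := bmf_norm_lt e sZ.
have bZ := sbmfW sZ; have bI := sbmfW sI.
have bxi := sbmfW (xiM.1 (m + k)%N).
have s2 : sbmf (m + k) (fun w => 2 * (stopped e m k w * I w)).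
  by apply: bmfZ; exact: bmfM.
have := xiM.2 (m + k)%N _ s2.
have b2 := sbmfW s2.
have b3 : bmf (fun w => 2 * (stopped e m k w * I w) * xi (m + k)%N w).
  exact: bmfM.
have b1 := bmf_sqr bZ; have b4 := bmf_sqr bxi => H.
apply: le_trans (lerD IH (xi_v (m + k)%N)).
rewrite -[X in X + _]addr0 -H -!bmf_intD//; last exact: bmfD.
apply: bmf_int_le => //.
- by apply: bmf_sqr; apply: bmfD => //; exact: bmfM.
- by apply: bmfD => //; exact: bmfD.
move=> w; rewrite /= -/(I w) -subr_ge0.
have [->|->] : I w = 1 \/ I w = 0 by rewrite /I; case: (_ < _); [left|right].
  by rewrite le_eqVlt; apply/orP; left; apply/eqP; ring.
rewrite [leRHS](_ : _ = xi (m + k)%N w ^+ 2); first exact: sqr_ge0.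
ring.
Qed.

Let stopped_lt e m k w : `|stopped e m k.+1 w| < e -> `|stopped e m k w| < e.
Proof.
move=> /=; case: (ltP `|stopped e m k w| e) => //= H.
by rewrite mul0r addr0 ltNge H.
Qed.

Let stopped_sum e m k w : `|stopped e m k w| < e ->
  stopped e m k w = \sum_(m <= t < m + k) xi t w.
Proof.
elim: k => [|k IH]; first by rewrite addn0 big_geq.
move=> /stopped_lt H; rewrite addnS big_nat_recr ?leq_addr//= H mul1r.
by rewrite IH.
Qed.

(** For a fixed level the bad event is that the sum started at [m] leaves [(-e, e)] at some time,
    for every [m]. Freezing makes these events increase with time, so the Chebyshev bound at each
    single time, a tail of [v] over [e ^+ 2], passes to their union. *)
Lemma martingale_cauchy : \forall w \ae P, forall e : R, 0 < e ->
  exists m, forall n, (m <= n)%N -> `|\sum_(m <= t < n) xi t w| < e.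
Proof.
have P1 : P setT = 1%E by exact: probability_setT.
have v0 t : 0 <= v t.
  by apply: le_trans (xi_v t); apply: Rintegral_ge0 => w _; exact: sqr_ge0.
(* Countably many levels suffice, since null sets may be united over [i]. *)
suff H : forall i : nat, \forall w \ae P, exists m, forall k,
    `|stopped i.+1%:R^-1 m k w| < i.+1%:R^-1.
  have {}H := ae_foralln H.
  apply: filterS H => w Hw e e0.
  have [i ie] : exists i : nat, i.+1%:R^-1 < e.
    have := near_infty_natSinv_lt (PosNum e0) => -[N _ HN].
    by exists N; exact: (HN N (leqnn N)).
  have [m Hm] := Hw i; exists m => n mn.
  have := Hm (n - m)%N; move=> {}Hm; move: (Hm).
  by rewrite stopped_sum// subnKC// => /lt_trans; apply.
move=> i; set e := i.+1%:R^-1.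
have e0 : 0 < e by rewrite /e invr_gt0.
pose A m k := [set w | e <= `|stopped e m k w|].
have bZ m k : bmf (stopped e m k) by exact: sbmfW.
have mA m k : measurable (A m k).
  have mn : measurable_fun setT (fun x => `|stopped e m k x|).
    by apply: measurableT_comp => //; case: (bZ m k).
  have := mn measurableT `[e, +oo[%classic (measurable_itv _); rewrite setTI.
  by congr measurable; apply/seteqP; split => x /=; rewrite in_itv /= andbT.
have PA m : (P (\bigcup_k A m k) <= ereal_sup (range (P \o A m)))%E.
  have ndA : nondecreasing_seq (A m).
    apply/nondecreasing_seqP => k; apply/subsetPset => w; rewrite /A /=.
    by rewrite leNgt => H; rewrite leNgt; apply: contra H; exact: stopped_lt.
  have := @nondecreasing_cvg_mu _ _ _ P _ (mA m)
    (bigcup_measurable (fun k _ => mA m k)) ndA.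
  move=> /cvg_lim <-//; apply: lime_le.
    apply: ereal_nondecreasing_is_cvgn => a b ab; apply: le_measure; rewrite ?inE//.
    exact/subsetPset/ndA.
  by apply: nearW => k; apply: ereal_sup_ubound; exists k.
exists (\bigcap_m \bigcup_k A m k); split.
- by apply: bigcap_measurable => // m _; exact: bigcup_measurable.
- apply/eqP; rewrite eq_le measure_ge0 andbT; apply/lee_addgt0Pr => c c0.
  rewrite add0e.
  (* The threshold for the tail is chosen so that division by [e ^+ 2] in Chebyshev leaves exactly
     [c]. *)
  have ce : 0 < c * e ^+ 2 by rewrite mulr_gt0// exprn_gt0.
  have [m0 Hm0] := sum_tail_le v0 v_V ce.
  have m0m0 : measurable (\bigcup_k A m0 k) by exact: bigcup_measurable.
  apply: (@le_trans _ _ (P (\bigcup_k A m0 k))).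
    apply: le_measure; rewrite ?inE//.
      by apply: bigcap_measurable => // m _; exact: bigcup_measurable.
    by move=> w; exact.
  apply: le_trans (PA m0) _; apply: ge_ereal_sup => _ [k _ <-].
  have := chebyshev_sqr e0 (bZ m0 k) (le_trans (stopped_L2 e m0 k) (Hm0 m0 _ (leqnn _))).
  by rewrite mulfK// gt_eqF// exprn_gt0.
- move=> w /= Hw m _; apply: contrapT => H; apply: Hw; exists m => k.
  by rewrite ltNge; apply/negP => Hk; apply: H; exists k.
Qed.

End L2_martingale.

(** * Deterministic estimates *)

Section matrix_bounds.
Context {R : realType}.

Lemma mx_entry_le_norm m n (A : 'M[R]_(m, n)) i j : `|A i j| <= `|A|.
Proof.
rewrite [leRHS]/Num.norm/= mx_normrE;
exact: (le_bigmax _ (fun k : 'I_m * 'I_n => `|A k.1 k.2|) (i, j)).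
Qed.

Lemma mx_norm_le m n (A : 'M[R]_(m, n)) c : 0 <= c ->
  (forall i j, `|A i j| <= c) -> `|A| <= c.
Proof.
by move=> c0 Ac; rewrite [leLHS]/Num.norm/= mx_normrE; apply: bigmax_le => // -[i j] _.
Qed.

Lemma norm_mulmx m n p (A : 'M[R]_(m, n)) (B : 'M[R]_(n, p)) :
  `|A *m B| <= n%:R * `|A| * `|B|.
Proof.
apply: mx_norm_le => [|i j]; first by rewrite !mulr_ge0.
rewrite mxE (le_trans (ler_norm_sum _ _ _))//.
apply: (@le_trans _ _ (\sum_(k < n) `|A| * `|B|)).
  by apply: ler_sum => k _; rewrite normrM ler_pM// mx_entry_le_norm.
by rewrite sumr_const card_ord -[leLHS]mulr_natl mulrA.
Qed.

(** The square of [enorm] as a polynomial in the entries, so that it expands and integrates term by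
    term. Size estimates use the sup norm instead; the two differ by factors of the dimension. *)
Definition sqnorm n (u : 'cV[R]_n) : R := \sum_i u i 0 ^+ 2.

Lemma sqnorm_ge0 n (u : 'cV[R]_n) : 0 <= sqnorm u.
Proof. by apply: sumr_ge0 => i _; exact: sqr_ge0. Qed.

Lemma dotE n (u v : 'cV[R]_n) : dot u v = \sum_i u i 0 * v i 0.
Proof. by rewrite /dot mxE; apply: eq_bigr => i _; rewrite mxE. Qed.

Lemma sqnormE n (u : 'cV[R]_n) : sqnorm u = dot u u.
Proof. by rewrite dotE; apply: eq_bigr => i _; rewrite expr2. Qed.

Lemma dotC n (u v : 'cV[R]_n) : dot u v = dot v u.
Proof. by rewrite !dotE; apply: eq_bigr => i _; rewrite mulrC. Qed.

Lemma dotDr n (u v w : 'cV[R]_n) : dot u (v + w) = dot u v + dot u w.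
Proof. by rewrite /dot mulmxDr mxE. Qed.

Lemma dotNr n (u v : 'cV[R]_n) : dot u (- v) = - dot u v.
Proof. by rewrite /dot mulmxN mxE. Qed.

Lemma dotZr n c (u v : 'cV[R]_n) : dot u (c *: v) = c * dot u v.
Proof. by rewrite /dot -scalemxAr mxE. Qed.

Lemma dotDl n (u v w : 'cV[R]_n) : dot (u + v) w = dot u w + dot v w.
Proof. by rewrite dotC dotDr !(dotC w). Qed.

Lemma dotZl n c (u v : 'cV[R]_n) : dot (c *: u) v = c * dot u v.
Proof. by rewrite dotC dotZr dotC. Qed.

Lemma dotNl n (u v : 'cV[R]_n) : dot (- u) v = - dot u v.
Proof. by rewrite dotC dotNr dotC. Qed.

Lemma norm_dot n (u v : 'cV[R]_n) : `|dot u v| <= n%:R * `|u| * `|v|.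
Proof.
apply: le_trans (mx_entry_le_norm _ 0 0) _.
apply: le_trans (norm_mulmx _ _) _; rewrite ler_wpM2r// ler_wpM2l//.
by apply: mx_norm_le => // i j; rewrite mxE mx_entry_le_norm.
Qed.

Lemma sqnorm_le n (u : 'cV[R]_n) : sqnorm u <= n%:R * `|u| ^+ 2.
Proof.
by rewrite sqnormE (le_trans (ler_norm _))// (le_trans (norm_dot _ _))// expr2 mulrA.
Qed.

Lemma norm_le_sqnorm n (u : 'cV[R]_n) : `|u| ^+ 2 <= sqnorm u.
Proof.
rewrite -[leRHS]sqr_sqrtr ?sqnorm_ge0//.
rewrite lerXn2r ?nnegrE ?sqrtr_ge0//; apply: mx_norm_le => [|i j].
  exact: sqrtr_ge0.
rewrite -[leLHS]sqrtr_sqr ler_sqrt ?sqnorm_ge0// (ord1 j).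
by rewrite /sqnorm (bigD1 i)//= lerDl; apply: sumr_ge0 => k _; exact: sqr_ge0.
Qed.

Lemma norm_le1_sqnorm n (u : 'cV[R]_n) : `|u| <= 1 + sqnorm u.
Proof. by have := norm_le_sqnorm u; have := sqr_ge0 (`|u| - 1); nra. Qed.

End matrix_bounds.

Lemma extract_subseq (Q : nat -> nat -> Prop) :
  (forall k N, exists2 n, (N <= n)%N & Q k n) ->
  exists phi : nat -> nat,
    {homo phi : i j / (i < j)%N} /\ forall k, Q k (phi k).
Proof.
move=> H; have H' k N : {n | (N <= n)%N & Q k n} by exact: (cid2 (H k N)).
pose f k N := s2val (H' k N).
pose phi := fix F k := if k is k'.+1 then f k (F k').+1 else f 0%N 0%N.
exists phi; split.
  by apply: homo_ltn => [i j k|i]; [exact: ltn_trans|exact: (s2valP (H' _ _))].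
by case=> [|k]; exact: (s2valP' (H' _ _)).
Qed.

Lemma homo_ltn_geq (phi : nat -> nat) k :
  {homo phi : i j / (i < j)%N} -> (k <= phi k)%N.
Proof.
move=> h; elim: k => // k IH; apply: leq_ltn_trans IH _; exact: h.
Qed.

Lemma bounded_cvg_subseq {R : realType} n (u : nat -> 'cV[R]_n) (L : R) :
  (forall k, `|u k| <= L) ->
  exists (phi : nat -> nat) (l : 'cV[R]_n),
    {homo phi : i j / (i < j)%N} /\ (fun k => u (phi k)) @ \oo --> l.
Proof.
(* Columns are transposed to rows, the form in which [bounded_closed_compact] is stated. *)
move=> uL; pose v k : 'rV[R]_n := (u k)^T.
pose B := closed_ball_ Num.norm (0 : 'rV[R]_n) L.
have vB k : B (v k).
  rewrite /B /closed_ball_/= sub0r normrN.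
  have L0 : 0 <= L by exact: le_trans (uL k).
  by apply: mx_norm_le => // i j; rewrite mxE (le_trans (mx_entry_le_norm _ _ _)).
have cB : compact B.
  apply: bounded_closed_compact; last exact: closed_closed_ball_.
  exists L; split; first exact: num_real.
  move=> M LM x; rewrite /B /closed_ball_/= sub0r normrN => /le_trans; apply.
  exact: ltW.
have vF : (v @ \oo) B by exists 0%N => // k _; exact: vB.
have [l [_ cl]] := cB (v @ \oo) _ vF.
have [phi [hphi Hphi]] : exists phi, {homo phi : i j / (i < j)%N} /\
    forall k, `|l - v (phi k)| < k.+1%:R^-1.
  apply: (@extract_subseq (fun k m => `|l - v m| < k.+1%:R^-1)) => k N.
  have := cl [set v i | i in [set i | (N <= i)%N]] (ball l k.+1%:R^-1).
  case.
  - by exists N => // i /= Ni; exists i.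
  - by apply: nbhsx_ballx; rewrite invr_gt0.
  - by move=> x [[i /= Ni <-]]; rewrite -ball_normE => H; exists i.
exists phi, l^T; split => //.
apply/cvgrPdist_lt => e e0.
near=> k.
apply: (@le_lt_trans _ _ `|l - v (phi k)|).
  apply: mx_norm_le => // i j.
  have -> : (l^T - u (phi k)) i j = (l - v (phi k)) j i by rewrite !mxE.
  exact: mx_entry_le_norm.
apply: lt_trans (Hphi k) _.
near: k; exact: (near_infty_natSinv_lt (PosNum e0)).
Unshelve. all: by end_near.
Qed.

(** * Step-size sums and the Lyapunov inequality *)

Section step_sizes.
Context {R : realType} (alpha : nat -> R).
Hypothesis alpha_gt0 : forall t, 0 < alpha t.
Hypothesis alpha_decr : forall t, alpha t.+1 <= alpha t.
Variable V : R.
Hypothesis alpha_V : forall n, \sum_(0 <= t < n) alpha t ^+ 2 <= V.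

Lemma step_small e : 0 < e -> exists t0, forall t, (t0 <= t)%N -> alpha t <= e.
Proof.
move=> e0; have e2 : 0 < e ^+ 2 by rewrite exprn_gt0.
have [m0 Hm] := sum_tail_le (fun t => sqr_ge0 (alpha t)) alpha_V e2.
exists m0 => t tm; have := Hm t t.+1 tm; rewrite big_nat1.
by rewrite ler_pXn2r// nnegrE ltW.
Qed.

(* [y t + 2 alpha t Q t] decreases up to errors summable relative to [y]. *)
Lemma lyapunov_bounded (y f Q : nat -> R) (C : R) :
    0 <= C -> (forall t, 0 <= y t) -> (forall t, 0 <= f t) ->
    (forall t, `|Q t| <= C * y t) ->
    (forall t, y t.+1 <= y t - 2 * alpha t * f t
      + 2 * alpha t * (Q t - Q t.+1) + C * alpha t ^+ 2 * y t) ->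
  exists K, (forall t, y t <= K) /\
    forall n, \sum_(0 <= t < n) alpha t * f t <= K.
Proof.
move=> C0 y0 f0 QC yS.
have C1 : 0 < C + 1 by rewrite ltr_wpDl.
(* From [t0] on this makes both [C * alpha t] and [C] times the remaining sum of squared steps at
   most 1/16. *)
have D0 : 0 < (16 * (C + 1))^-1 by rewrite invr_gt0 mulr_gt0.
have D1 : (16 * (C + 1))^-1 * (C + 1) = 16^-1 by field; rewrite gt_eqF.
set D := (16 * _)^-1 in D0 D1.
have [ta Hta] := step_small D0.
have [tb Htb] := sum_tail_le (fun t => sqr_ge0 (alpha t)) alpha_V D0.
pose t0 := maxn ta tb.
have aD t : (t0 <= t)%N -> C * alpha t <= 16^-1.
  move=> tt; have := Hta t (leq_trans (leq_maxl _ _) tt); have := alpha_gt0 t.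
  nra.
have sD n : C * \sum_(t0 <= t < n) alpha t ^+ 2 <= 16^-1.
  have := Htb t0 n (leq_maxr _ _).
  have : 0 <= \sum_(t0 <= t < n) alpha t ^+ 2.
    by apply: sumr_ge0 => *; exact: sqr_ge0.
  nra.
(* The factor 4 closes the induction: the estimate below amounts to [(1 - 2/16) * y n.+1 <= (1 +
   2/16) * y t0 + (3/16) * B], whose solution is [y n.+1 <= (15/7) * y t0]. *)
pose B := 4 * y t0.
pose S n := \sum_(t0 <= t < n) alpha t ^+ 2.
pose F n := \sum_(t0 <= t < n) alpha t * f t.
have B0 : 0 <= B by rewrite mulr_ge0.
(* The two claims need each other: the accumulated error is bounded through [y <= B] at earlier
   times, and the accumulated inequality then yields [y <= B] at the next time. *)
have P k : y (t0 + k)%N <= B /\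
    y (t0 + k)%N + 2 * alpha (t0 + k)%N * Q (t0 + k)%N + 2 * F (t0 + k)%N
    <= y t0 + 2 * alpha t0 * Q t0
      + B * (2 * C * (alpha t0 - alpha (t0 + k)%N) + C * S (t0 + k)%N).
  elim: k => [|k [IH1 IH2]].
    rewrite addn0 /F /S !big_geq//; split; first by have := y0 t0; rewrite /B; lra.
    by rewrite !mulr0 subrr !addr0 !mulr0 addr0.
  rewrite addnS; set n := (t0 + k)%N in IH1 IH2 *.
  have t0n : (t0 <= n)%N by exact: leq_addr.
  have FS : F n.+1 = F n + alpha n * f n by rewrite /F big_nat_recr.
  have SS : S n.+1 = S n + alpha n ^+ 2 by rewrite /S big_nat_recr.
  have H := yS n.
  have F0 : 0 <= F n.+1.
    by apply: sumr_ge0 => t _; rewrite mulr_ge0// ltW.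
  have a1 := aD n t0n; have a2 := sD n.+1; rewrite -/(S n.+1) in a2.
  have a0 := aD t0 (leqnn _).
  have g1 := alpha_gt0 n.+1; have g0 := alpha_gt0 n; have d := alpha_decr n.
  have Qn1 := QC n.+1; rewrite ler_norml in Qn1; case/andP: Qn1 => Ql Qu.
  have Q0 := QC t0; rewrite ler_norml in Q0; case/andP: Q0 => _ Q0.
  have T1 : 2 * (alpha n.+1 - alpha n) * Q n.+1
      <= 2 * C * (alpha n - alpha n.+1) * y n.+1.
    have : 0 <= (alpha n - alpha n.+1) * (Q n.+1 + C * y n.+1).
      by apply: mulr_ge0; lra.
    lra.
  have T2 : C * alpha n ^+ 2 * y n <= B * (C * alpha n ^+ 2).
    rewrite [leRHS]mulrC ler_wpM2l// mulr_ge0//; exact: sqr_ge0.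
  have T3 : - (2 * alpha n.+1 * Q n.+1) <= 2 * C * alpha n.+1 * y n.+1.
    have : 0 <= alpha n.+1 * (Q n.+1 + C * y n.+1).
      by apply: mulr_ge0; lra.
    lra.
  have T4 : 2 * alpha t0 * Q t0 <= 2 * (C * alpha t0) * y t0.
    have := alpha_gt0 t0 => ga.
    have : 0 <= alpha t0 * (C * y t0 - Q t0) by apply: mulr_ge0; lra.
    lra.
  have T4' : (C * alpha t0) * y t0 <= 16^-1 * y t0 by rewrite ler_wpM2r.
  have T5 : (C * alpha n) * y n.+1 <= 16^-1 * y n.+1 by rewrite ler_wpM2r.
  have T6 : B * (2 * C * (alpha t0 - alpha n) + C * S n.+1) <= B * (3 * 16^-1).
    rewrite ler_wpM2l//; have : 0 <= C * alpha n by rewrite mulr_ge0// ltW.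
    lra.
  have T6' : B * (2 * C * (alpha t0 - alpha n) + C * S n.+1) =
     B * (2 * C * (alpha t0 - alpha n) + C * S n) + B * (C * alpha n ^+ 2).
    by rewrite SS; ring.
  have yB : y n.+1 <= B.
    rewrite FS in F0.
    have : y n.+1 - 2 * (C * alpha n) * y n.+1 <= y t0 + 2 * alpha t0 * Q t0
       + B * (3 * 16^-1) by lra.
    have := y0 t0; have := y0 n.+1; rewrite /B; lra.
  split=> //.
  have T7 : 2 * C * (alpha n - alpha n.+1) * y n.+1
      <= B * (2 * C * (alpha n - alpha n.+1)).
    by rewrite [leRHS]mulrC ler_wpM2l// !mulr_ge0//; lra.
  rewrite FS SS; lra.
have P' n : (t0 <= n)%N -> 2 * F n <= 4 * y t0 + B.
  move=> tn; have [yB] := P (n - t0)%N; rewrite subnKC// => H.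
  have Q0 := QC t0; rewrite ler_norml in Q0; case/andP: Q0 => _ Q0.
  have Qn := QC n; rewrite ler_norml in Qn; case/andP: Qn => Qn _.
  have ga := alpha_gt0 t0; have gn := alpha_gt0 n.
  have a0 := aD t0 (leqnn _); have an := aD n tn; have as2 := sD n.
  rewrite -/(S n) in as2.
  have T4 : 2 * alpha t0 * Q t0 <= 2 * (C * alpha t0) * y t0.
    have : 0 <= alpha t0 * (C * y t0 - Q t0) by apply: mulr_ge0; lra.
    lra.
  have T4' : (C * alpha t0) * y t0 <= 16^-1 * y t0 by rewrite ler_wpM2r.
  have T3 : - (2 * alpha n * Q n) <= 2 * (C * alpha n) * y n.
    have : 0 <= alpha n * (Q n + C * y n) by apply: mulr_ge0; lra.
    lra.
  have T5 : (C * alpha n) * y n <= 16^-1 * y n by rewrite ler_wpM2r.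
  have T6 : B * (2 * C * (alpha t0 - alpha n) + C * S n) <= B * (3 * 16^-1).
    rewrite ler_wpM2l//; have : 0 <= C * alpha n by rewrite mulr_ge0// ltW.
    lra.
  have := y0 t0; have := y0 n; lra.
(* The finitely many times before [t0] are absorbed by their sums. *)
pose Y := \sum_(0 <= t < t0) y t; pose F0 := \sum_(0 <= t < t0) alpha t * f t.
have Y0 : 0 <= Y by apply: sumr_ge0.
have af t : 0 <= alpha t * f t by rewrite mulr_ge0// ltW.
have F00 : 0 <= F0 by apply: sumr_ge0.
exists (Y + F0 + 4 * y t0 + B); split => [t|n].
  have [tt|tt] := leqP t0 t.
    by have [+ _] := P (t - t0)%N; rewrite subnKC//; have := y0 t0; lra.
  have : y t <= Y.
    rewrite /Y (@big_cat_nat _ _ _ t)//=; last exact: ltnW.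
    rewrite [X in _ + X]big_ltn//.
    have : 0 <= \sum_(0 <= i < t) y i by apply: sumr_ge0.
    have : 0 <= \sum_(t.+1 <= i < t0) y i by apply: sumr_ge0.
    lra.
  by have := y0 t0; lra.
have [tn|nt] := leqP t0 n.
  rewrite (@big_cat_nat _ _ _ t0)//=; have := P' n tn; rewrite /F -/F0.
  have := y0 t0; rewrite /B; lra.
have : \sum_(0 <= t < n) alpha t * f t <= F0.
  rewrite /F0 [leRHS](@big_cat_nat _ _ _ n)//=; last exact: ltnW.
  by rewrite lerDl; apply: sumr_ge0.
by have := y0 t0; lra.
Qed.

(** Were [F] above [e] from [N] on, the bounded weighted sum would dominate [e] times the divergent
    sum of the steps. *)
Lemma frequently_small (F : nat -> R) (K : R) :
    series alpha @ \oo --> +oo ->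
    (forall n, \sum_(0 <= t < n) alpha t * F t <= K) -> (forall t, 0 <= F t) ->
  forall (e : R) N, 0 < e -> exists2 n, (N <= n)%N & F n <= e.
Proof.
move=> aoo FK F0 e N e0; apply: contrapT => H.
have Fe n : (N <= n)%N -> e < F n.
  by move=> Nn; rewrite ltNge; apply/negP => Fn; apply: H; exists n.
pose S n := \sum_(0 <= t < n) alpha t.
have SK n : (N <= n)%N -> S n <= S N + K / e.
  move=> Nn; rewrite /S (@big_cat_nat _ _ _ N)//= lerD2l ler_pdivlMr// mulrC.
  apply: le_trans (FK n); rewrite [leRHS](@big_cat_nat _ _ _ N)//=.
  rewrite -[leLHS]add0r lerD//.
    by apply: sumr_ge0 => t _; rewrite mulr_ge0// ltW.
  rewrite mulr_sumr !big_nat; apply: ler_sum => t /andP[Nt _].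
  by rewrite mulrC ler_wpM2l// ltW// Fe.
have [m0 _ Hm] : \forall n \near \oo, S N + K / e + 1 <= S n.
  by move/cvgryPge : aoo; exact.
have := Hm (maxn m0 N) (leq_maxl _ _); have := SK (maxn m0 N) (leq_maxr _ _).
lra.
Qed.

End step_sizes.

(** * Deterministic analysis along one sample path *)

Section pathwise.
Context {R : realType} (n : nat) (alpha : nat -> R).
Hypothesis alpha_gt0 : forall t, 0 < alpha t.
Hypothesis alpha_decr : forall t, alpha t.+1 <= alpha t.
Variable V : R.
Hypothesis alpha_V : forall N, \sum_(0 <= t < N) alpha t ^+ 2 <= V.
Variables (A : 'M[R]_n) (M N : nat -> 'M[R]_n) (u : nat -> 'cV[R]_n) (C : R).
Hypothesis NC : forall t, `|N t| <= C.
Hypothesis BC : forall t, `|A + M t + N t - N t.+1| <= C.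
Hypothesis uS : forall t,
  u t.+1 = u t + alpha t *: ((A + M t + N t - N t.+1) *m u t).

(** Its summability is all that is needed from the moment bounds. The first summand controls the
    drift on a window, the second the change of [u] in one step, the third the change of the step
    size in the summation by parts. *)
Let g t := alpha t * sqnorm (A *m u t) + alpha t ^+ 2 * sqnorm (u t)
  + (alpha t - alpha t.+1) * sqnorm (u t.+1).

Variable W : R.
Hypothesis gW : forall k, \sum_(0 <= t < k) g t <= W.
Hypothesis M_cauchy : forall i (e : R), 0 < e -> exists m, forall k, (m <= k)%N ->
  `|\sum_(m <= t < k) alpha t * (M t *m u t) i 0| < e.

Let g1 t : 0 <= alpha t * sqnorm (A *m u t).
Proof. by rewrite mulr_ge0 ?sqnorm_ge0// ltW. Qed.

Let g2 t : 0 <= alpha t ^+ 2 * sqnorm (u t).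
Proof. by rewrite mulr_ge0 ?sqnorm_ge0// sqr_ge0. Qed.

Let g3 t : 0 <= (alpha t - alpha t.+1) * sqnorm (u t.+1).
Proof. by rewrite mulr_ge0 ?sqnorm_ge0// subr_ge0. Qed.

Let g0 t : 0 <= g t.
Proof. by rewrite /g !addr_ge0. Qed.

Let C0 : 0 <= C. Proof. exact: le_trans (NC 0). Qed.

Let martingale_part_small e : 0 < e -> exists m0, forall m k,
  (m0 <= m)%N -> (m <= k)%N -> `|\sum_(m <= t < k) alpha t *: (M t *m u t)| <= e.
Proof.
move=> e0; have e2 : 0 < e / 2 by rewrite divr_gt0.
have H i : exists m0, forall m k, (m0 <= m)%N -> (m <= k)%N ->
    `|\sum_(m <= t < k) alpha t * (M t *m u t) i 0| <= e.
  have [m0 Hm0] := M_cauchy i e2; exists m0 => m k m0m mk.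
  have h1 := Hm0 m m0m; have h2 := Hm0 k (leq_trans m0m mk).
  rewrite (@big_cat_nat _ _ _ m)//= in h2.
  move: h1 h2; rewrite !ltr_norml ler_norml => /andP[? ?] /andP[? ?].
  by apply/andP; split; lra.
have [f Hf] := choice H.
exists (\max_i f i)%N => m k fm mk; apply: mx_norm_le => [|i j]; first exact: ltW.
rewrite (ord1 j) summxE; under eq_bigr do rewrite mxE.
by apply: (Hf i) => //; apply: leq_trans fm; exact: leq_bigmax.
Qed.

(** Remainder of the summation by parts: replacing [alpha t *: (N t.+1 *m u t)] by the boundary term
    at [t.+1] alters both the step size and the iterate. *)
Let s t := (alpha t.+1 - alpha t) *: (N t.+1 *m u t.+1)
  + alpha t *: (N t.+1 *m (u t.+1 - u t)).

Let abel m k : \sum_(m <= t < m + k) alpha t *: ((M t + N t - N t.+1) *m u t)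
  = \sum_(m <= t < m + k) alpha t *: (M t *m u t)
    + (alpha m *: (N m *m u m) - alpha (m + k)%N *: (N (m + k)%N *m u (m + k)%N))
    + \sum_(m <= t < m + k) s t.
Proof.
elim: k => [|k IH]; first by rewrite addn0 !big_geq// subrr !addr0.
rewrite addnS !big_nat_recr ?leq_addr//= IH /s.
set t := (m + k)%N.
rewrite mulmxBl mulmxDl mulmxBr.
set p1 := \sum_(_ <= _ < _) _; set p2 := \sum_(_ <= _ < _) _.
set a1 := N t *m u t; set a2 := N t.+1 *m u t.+1; set a3 := N t.+1 *m u t.
set a4 := M t *m u t; set a0 := N m *m u m.
by apply/matrixP => i j; rewrite !mxE; ring.
Qed.

(** One factor [n%:R * C] bounds the action of [N]; a second one appears where [N] acts on the
    increment of [u]. *)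
Let D := n%:R * C + (n%:R * C) ^+ 2.

Let nC0 : 0 <= n%:R * C. Proof. by rewrite mulr_ge0. Qed.

Let D0 : 0 <= D. Proof. by rewrite addr_ge0// sqr_ge0. Qed.

Let step_le t : `|u t.+1 - u t| <= alpha t * (n%:R * C * `|u t|).
Proof.
rewrite uS addrC addKr normrZ gtr0_norm// ler_wpM2l ?(ltW (alpha_gt0 t))//.
by apply: le_trans (norm_mulmx _ _) _; rewrite ler_wpM2r// ler_wpM2l.
Qed.

Let s_le t : `|s t| <= D * (g t + (alpha t - alpha t.+1) + alpha t ^+ 2).
Proof.
have N1 (v : 'cV[R]_n) : `|N t.+1 *m v| <= n%:R * C * `|v|.
  by apply: le_trans (norm_mulmx _ _) _; rewrite ler_wpM2r// ler_wpM2l.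
have d : 0 <= alpha t - alpha t.+1 by rewrite subr_ge0.
apply: (@le_trans _ _ ((alpha t - alpha t.+1) * (n%:R * C * `|u t.+1|)
    + alpha t * (n%:R * C * (alpha t * (n%:R * C * `|u t|))))).
  apply: le_trans (ler_normD _ _) _; rewrite !normrZ lerD//.
    by rewrite distrC ger0_norm// ler_wpM2l// N1.
  rewrite gtr0_norm// ler_wpM2l ?(ltW (alpha_gt0 t))//.
  apply: le_trans (N1 _) _.
  by rewrite ler_wpM2l.
have u1 := norm_le1_sqnorm (u t.+1); have u0 := norm_le1_sqnorm (u t).
apply: (@le_trans _ _ ((n%:R * C) * ((alpha t - alpha t.+1) * (1 + sqnorm (u t.+1)))
   + (n%:R * C) ^+ 2 * (alpha t ^+ 2 * (1 + sqnorm (u t))))).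
  apply: lerD.
    by rewrite mulrCA ler_wpM2l// ler_wpM2l.
  rewrite [leLHS](_ : _ = (n%:R * C) ^+ 2 * (alpha t ^+ 2 * `|u t|)); last by ring.
  by rewrite ler_wpM2l ?sqr_ge0// ler_wpM2l// sqr_ge0.
set E1 := (alpha t - _) * _; set E2 := alpha t ^+ 2 * _.
have E10 : 0 <= E1 by rewrite mulr_ge0// addr_ge0// sqnorm_ge0.
have E20 : 0 <= E2 by rewrite mulr_ge0 ?sqr_ge0// addr_ge0// sqnorm_ge0.
apply: (@le_trans _ _ (D * (E1 + E2))).
  have : 0 <= n%:R * C * E2 by rewrite mulr_ge0.
  have : 0 <= (n%:R * C) ^+ 2 * E1 by rewrite mulr_ge0// sqr_ge0.
  by rewrite /D; lra.
rewrite ler_wpM2l// /E1 /E2 /g; have := g1 t; lra.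
Qed.

Let small d : 0 < d -> exists m0, forall m, (m0 <= m)%N ->
  [/\ alpha m * `|u m| <= d, alpha m <= d,
      forall k, \sum_(m <= t < k) g t <= d &
      forall k, \sum_(m <= t < k) alpha t ^+ 2 <= d].
Proof.
move=> d0; have d2 : 0 < d ^+ 2 by rewrite exprn_gt0.
(* A single term [g m] dominates the square of [alpha m] times the norm of [u m], hence the
   threshold [d ^+ 2] for the first bound. *)
have [m1 H1] := sum_tail_le g0 gW d2.
have [m2 H2] := step_small alpha_gt0 alpha_V d0.
have [m3 H3] := sum_tail_le g0 gW d0.
have [m4 H4] := sum_tail_le (fun t => sqr_ge0 (alpha t)) alpha_V d0.
exists (maxn (maxn m1 m2) (maxn m3 m4)) => m.
rewrite !geq_max => /andP[/andP[h1 h2] /andP[h3 h4]]; split=> [||k|k].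
- have := H1 m m.+1 h1; rewrite big_nat1 => gm.
  have a0 := ltW (alpha_gt0 m).
  rewrite -(@ler_pXn2r _ 2)// ?nnegrE ?mulr_ge0//; last exact: ltW.
  apply: le_trans gm; rewrite exprMn.
  have := norm_le_sqnorm (u m); rewrite /g.
  have := g1 m; have := g3 m; have := sqr_ge0 (alpha m); nra.
- exact: H2.
- exact: H3.
- exact: H4.
Qed.

Lemma noise_small e : 0 < e -> exists m0, forall m k,
  (m0 <= m)%N -> (m <= k)%N ->
  `|\sum_(m <= t < k) alpha t *: ((M t + N t - N t.+1) *m u t)| <= e.
Proof.
(* In units of [d]: one for the martingale sum, [n%:R * C] for each of the two boundary terms, and
   three times [D] for the remainder, whose bound has three summable parts. *)
move=> e0; pose X := 1 + 2 * (n%:R * C) + 3 * D.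
have X0 : 0 < X.
  by rewrite /X -addrA ltr_pwDl// addr_ge0// mulr_ge0.
have d0 : 0 < e / X by rewrite divr_gt0.
have [m1 H1] := martingale_part_small d0; have [m2 H2] := small d0.
have dX : e / X * X = e by rewrite divfK// gt_eqF.
set d := e / X in d0 dX H1 H2 *.
exists (maxn m1 m2) => m k; rewrite geq_max => /andP[m1m m2m] mk.
have [um am gm sm] := H2 m m2m.
have [uk _ _ _] := H2 k (leq_trans m2m mk).
have := abel m (k - m)%N; rewrite subnKC// => ->.
have Nv t (v : 'cV[R]_n) : `|N t *m v| <= n%:R * C * `|v|.
  by apply: le_trans (norm_mulmx _ _) _; rewrite ler_wpM2r// ler_wpM2l.
have bd t : alpha t * `|u t| <= d -> `|alpha t *: (N t *m u t)| <= n%:R * C * d.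
  move=> ad; rewrite normrZ gtr0_norm//.
  apply: (@le_trans _ _ (alpha t * (n%:R * C * `|u t|))).
    by rewrite ler_wpM2l// ltW.
  by rewrite mulrCA ler_wpM2l.
have ss : `|\sum_(m <= t < k) s t| <= D * (3 * d).
  apply: le_trans (ler_norm_sum _ _ _) _.
  apply: (@le_trans _ _ (\sum_(m <= t < k)
      D * (g t + (alpha t - alpha t.+1) + alpha t ^+ 2))).
    by apply: ler_sum => t _; exact: s_le.
  rewrite -mulr_sumr ler_wpM2l// big_split/= [X in X + _ <= _]big_split/=.
  have -> : \sum_(m <= t < k) (alpha t - alpha t.+1) = alpha m - alpha k.
    rewrite -[RHS]opprB -telescope_sumr// -sumrN.
    by apply: eq_bigr => t _; rewrite opprB.
  have := gm k; have := sm k; have := alpha_gt0 k; lra.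
apply: le_trans (ler_normD _ _) _.
apply: le_trans (lerD (ler_normD _ _) ss) _.
apply: le_trans (lerD (lerD (H1 m k m1m mk) (ler_normB _ _)) (lexx _)) _.
have := bd m um; have := bd k uk; rewrite -dX /X; lra.
Qed.

Lemma window_small T e : 0 < T -> 0 < e -> exists m0, forall m k,
  (m0 <= m)%N -> (m <= k)%N -> \sum_(m <= t < k) alpha t <= T ->
  `|u k - u m| <= e.
Proof.
move=> T0 e0; have e2 : 0 < e / 2 by rewrite divr_gt0.
(* The drift is bounded by the inequality [a <= d + d^-1 * a ^+ 2] instead of a square root. With
   step mass at most [T] the first part sums to at most [e / 4], and the tail of [g] below
   [d * (e / 4)] gives the same for the second. *)
pose d := e / (4 * T).
have d0 : 0 < d by rewrite divr_gt0// mulr_gt0.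
have dT : d * T = e / 4 by rewrite /d; field; rewrite gt_eqF.
have de0 : 0 < d * (e / 4) by rewrite mulr_gt0// divr_gt0.
have [m1 H1] := noise_small e2; have [m2 H2] := sum_tail_le g0 gW de0.
exists (maxn m1 m2) => m k; rewrite geq_max => /andP[m1m m2m] mk aT.
have -> : u k - u m = \sum_(m <= t < k) alpha t *: (A *m u t)
    + \sum_(m <= t < k) alpha t *: ((M t + N t - N t.+1) *m u t).
  rewrite -telescope_sumr// -big_split/=; apply: eq_bigr => t _.
  by rewrite uS [LHS]addrC addKr -scalerDr -mulmxDl !addrA.
apply: le_trans (ler_normD _ _) _.
have := H1 m k m1m mk.
suff : `|\sum_(m <= t < k) alpha t *: (A *m u t)| <= e / 2 by lra.
apply: le_trans (ler_norm_sum _ _ _) _.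
apply: (@le_trans _ _ (\sum_(m <= t < k) (d * alpha t + d^-1 * g t))).
  apply: ler_sum => t _; rewrite normrZ gtr0_norm//.
  set a := `|A *m u t|.
  have ad : a <= d + d^-1 * a ^+ 2.
    have -> : d + d^-1 * a ^+ 2 = d^-1 * (d ^+ 2 + a ^+ 2).
      by field; rewrite gt_eqF.
    rewrite ler_pdivlMl//; have := sqr_ge0 (d - a); have := sqr_ge0 d.
    have := sqr_ge0 a; nra.
  have a1 := alpha_gt0 t.
  apply: (@le_trans _ _ (alpha t * (d + d^-1 * a ^+ 2))).
    by rewrite ler_wpM2l// ltW.
  rewrite mulrDr lerD//; first by rewrite mulrC.
  rewrite mulrCA ler_wpM2l ?invr_ge0 ?(ltW d0)//.
  apply: (@le_trans _ _ (alpha t * sqnorm (A *m u t))).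
    by rewrite ler_wpM2l ?(ltW (alpha_gt0 t))// norm_le_sqnorm.
  by rewrite /g; have := g2 t; have := g3 t; lra.
rewrite big_split/= -!mulr_sumr.
have := H2 m k m2m; rewrite -ler_pdivrMl// => h.
have : d * \sum_(m <= t < k) alpha t <= d * T by rewrite ler_wpM2l// ltW.
rewrite dT; lra.
Qed.

(** Being bounded infinitely often along [tk] allows two further extractions, first to a bounded and
    then to a convergent subsequence; summability along [tk] then forces [A *m l = 0] by
    continuity. *)
Lemma subsequence_window (tk : nat -> nat) (U L : R) :
    {homo tk : i j / (i < j)%N} ->
    (forall k, \sum_(0 <= i < k) sqnorm (A *m u (tk i)) <= U) ->
    (forall K, exists2 k, (K <= k)%N & sqnorm (u (tk k)) <= L) ->
  exists (sk : nat -> nat) (l : 'cV[R]_n),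
    [/\ {homo sk : i j / (i < j)%N}, (fun k => u (sk k)) @ \oo --> l,
        A *m l = 0 &
        forall T e : R, 0 < T -> 0 < e -> \forall k \near \oo, forall j,
          (sk k <= j)%N -> \sum_(sk k <= t < j) alpha t <= T ->
          `|u j - l| <= e].
Proof.
move=> tkS tkU tkL.
have [phi [phiS phiL]] :=
  @extract_subseq (fun _ k => sqnorm (u (tk k)) <= L) (fun _ => tkL).
have uL k : `|u (tk (phi k))| <= 1 + L.
  by apply: le_trans (norm_le1_sqnorm _) _; rewrite lerD2l.
have [psi [l [psiS ul]]] := bounded_cvg_subseq uL.
pose sk k := tk (phi (psi k)).
have skS : {homo sk : i j / (i < j)%N}.
  by move=> i j ij; apply: tkS; apply: phiS; exact: psiS.
have ul' e : 0 < e -> \forall k \near \oo, `|u (sk k) - l| < e.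
  by move=> e0; move/cvgrPdistC_lt : ul; apply.
exists sk, l; split => //.
- apply/eqP; rewrite -normr_le0; apply/ler_addgt0Pr => e e0; rewrite add0r.
  pose a := n%:R * `|A| + 1.
  have a0 : 0 < a by rewrite ltr_wpDl// mulr_ge0.
  have ea : 0 < e / (2 * a) by rewrite divr_gt0// mulr_gt0.
  have e2 : 0 < (e / 2) ^+ 2 by rewrite exprn_gt0// divr_gt0.
  have [k0 Hk0] := sum_tail_le (fun i => sqnorm_ge0 (A *m u (tk i))) tkU e2.
  have [k1 _ Hk1] := ul' _ ea.
  pose k := maxn k0 k1.
  have := Hk1 k (leq_maxr _ _); rewrite /= ltr_pdivlMr ?mulr_gt0// => uk.
  (* Strictly increasing extractions never lower an index, so the tail of the series along [tk]
     still applies. *)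
  have k0k : (k0 <= phi (psi k))%N.
    apply: leq_trans (leq_maxl k0 k1) _.
    by apply: leq_trans (homo_ltn_geq _ phiS); apply: leq_trans (homo_ltn_geq _ psiS) _.
  have := Hk0 _ (phi (psi k)).+1 k0k; rewrite big_nat1 -/(sk k) => Auk.
  have Auk' : `|A *m u (sk k)| <= e / 2.
    rewrite -(@ler_pXn2r _ 2)// ?nnegrE//; last by rewrite ltW// divr_gt0.
    by apply: le_trans (norm_le_sqnorm _) _.
  have -> : A *m l = A *m u (sk k) - A *m (u (sk k) - l).
    by rewrite mulmxBr opprB addrC subrK.
  apply: le_trans (ler_normB _ _) _.
  have := norm_mulmx A (u (sk k) - l).
  have : n%:R * `|A| * `|u (sk k) - l| <= a * `|u (sk k) - l|.
    by rewrite ler_wpM2r// /a lerDl.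
  lra.
- move=> T e T0 e0; have e2 : 0 < e / 2 by rewrite divr_gt0.
  have [m0 Hm0] := window_small T0 e2.
  have [k1 _ Hk1] := ul' _ e2.
  exists (maxn m0 k1) => // k; rewrite /= geq_max => /andP[m0k k1k] j kj aT.
  have := Hm0 _ _ (leq_trans m0k (homo_ltn_geq _ skS)) kj aT.
  have := Hk1 k k1k => /= h1 h2.
  rewrite -(subrK (u (sk k)) (u j)) -addrA.
  by apply: le_trans (ler_normD _ _) _; lra.
Qed.

End pathwise.

(** * Stochastic approximation with a dissipative mean field *)

Section random_vectors.
Context {R : realType} d (T : measurableType d) (n : nat).
Implicit Types (B : T -> 'M[R]_n) (v w : T -> 'cV[R]_n).

Lemma bmf_mulmx B v i : (forall i j, bmf (fun x => B x i j)) ->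
  (forall i, bmf (fun x => v x i 0)) -> bmf (fun x => (B x *m v x) i 0).
Proof.
move=> bB bv; under eq_fun do rewrite mxE.
by apply: bmf_sum => j; exact: bmfM.
Qed.

Lemma bmf_dot v w : (forall i, bmf (fun x => v x i 0)) ->
  (forall i, bmf (fun x => w x i 0)) -> bmf (fun x => dot (v x) (w x)).
Proof.
move=> bv bw; under eq_fun do rewrite dotE.
by apply: bmf_sum => j; exact: bmfM.
Qed.

Lemma bmf_sqnorm v : (forall i, bmf (fun x => v x i 0)) ->
  bmf (fun x => sqnorm (v x)).
Proof. by move=> bv; apply: bmf_sum => j; exact: bmf_sqr. Qed.

End random_vectors.

(** * Almost sure bounds from bounds in mean *)

Section almost_sure_bounds.
Context {R : realType} d (T : measurableType d) (P : probability T R).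

Lemma ae_sum_bounded (g : nat -> T -> R) (K : R) :
    (forall t, bmf (g t)) -> (forall t x, 0 <= g t x) ->
    (forall n, \sum_(0 <= t < n) \int[P]_x g t x <= K) ->
  \forall x \ae P, exists V, forall n, \sum_(0 <= t < n) g t x <= V.
Proof.
move=> bg g0 gK; have P1 : P setT = 1%E by exact: probability_setT.
pose S x := (\sum_(0 <= t <oo) (g t x)%:E)%E.
have mg t : measurable_fun setT (EFin \o g t).
  by apply/measurable_EFinP; case: (bg t).
have S0 x : (0 <= S x)%E by apply: nneseries_ge0 => t _ _; rewrite lee_fin.
have mS : measurable_fun setT S.
  by apply: ge0_emeasurable_sum => [t x _ _|t _]; [rewrite lee_fin|exact: mg].
have SK : (\int[P]_x S x <= K%:E)%E.
  rewrite integral_nneseries//; last by move=> t x _; rewrite lee_fin.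
  apply: lime_le.
    by apply: is_cvg_nneseries => t _ _; apply: integral_ge0 => x _; rewrite lee_fin.
  apply: nearW => N; under eq_bigr do rewrite bmf_EFin//.
  by rewrite sumEFin lee_fin.
have iS : P.-integrable setT S.
  apply/integrableP; split => //; under eq_integral do rewrite gee0_abs//.
  by apply: le_lt_trans SK _; rewrite ltry.
apply: filterS (integrable_ae measurableT iS) => x /(_ I) Sx.
exists (fine (S x)) => N; rewrite -lee_fin fineK// -sumEFin.
by apply: nneseries_lim_ge => t _ _; rewrite lee_fin.
Qed.

(** By Fatou the lower limit is integrable, hence finite almost everywhere, and the sequence is
    infinitely often below its lower limit plus one. *)
Lemma ae_frequently_bounded (g : nat -> T -> R) (K : R) :
    (forall t, bmf (g t)) -> (forall t x, 0 <= g t x) ->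
    (forall t, \int[P]_x g t x <= K) ->
  \forall x \ae P, exists L, forall m, exists2 k, (m <= k)%N & g k x <= L.
Proof.
move=> bg g0 gK; have P1 : P setT = 1%E by exact: probability_setT.
have mg t : measurable_fun setT (fun x => (g t x)%:E).
  by apply/measurable_EFinP; case: (bg t).
pose F x := limn_einf (fun t => (g t x)%:E).
have F0 x : (0 <= F x)%E.
  rewrite /F limn_einf_lim; apply: lime_ge; first exact: is_cvg_einfs.
  by apply: nearW => m; apply: le_ereal_inf_tmp => _ [k _ <-]; rewrite lee_fin.
have FK : (\int[P]_x F x <= K%:E)%E.
  apply: le_trans (fatou P measurableT mg _) _.
    by move=> t x _; rewrite lee_fin.
  rewrite limn_einf_lim; apply: lime_le; first exact: is_cvg_einfs.
  apply: nearW => m; apply: (@le_trans _ _ (\int[P]_x (g m x)%:E)%E).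
    by apply: ereal_inf_lbound; exists m => /=.
  by rewrite bmf_EFin// lee_fin.
have mF : measurable_fun setT F.
  have H : measurable_fun setT (fun x => limn_esup (fun t => (- (g t x)%:E)%E)).
    apply: (measurable_fun_limn_esup (f := fun t x => (- (g t x)%:E)%E)) => t.
    by apply: measurableT_comp.
  by apply: measurableT_comp.
have iF : P.-integrable setT F.
  apply/integrableP; split => //; under eq_integral do rewrite gee0_abs//.
  by apply: le_lt_trans FK _; rewrite ltry.
apply: filterS (integrable_ae measurableT iF) => x /(_ I) Fx.
exists (fine (F x) + 1) => m; apply: contrapT => H.
have gt k : (m <= k)%N -> fine (F x) + 1 < g k x.
  by move=> mk; rewrite ltNge; apply/negP => gk; apply: H; exists k.
have le_F z : (forall k, (m <= k)%N -> z < g k x) -> (z%:E <= F x)%E.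
  move=> zg; rewrite /F limn_einf_lim; apply: lime_ge; first exact: is_cvg_einfs.
  exists m => // j /= mj; apply: le_ereal_inf_tmp => _ [k /= jk <-].
  by rewrite lee_fin ltW//; apply: zg; exact: leq_trans jk.
have := le_F _ gt.
by rewrite -[leRHS]fineK// lee_fin gerDl leNgt ltr01.
Qed.

End almost_sure_bounds.

Section stochastic_approximation.
Context {R : realType} (n : nat) d (Omega : measurableType d).
Context (P : probability Omega R) (G : nat -> set (set Omega)).
Hypothesis GP : forall t, G t `<=` measurable.
Hypothesis GS : forall t, G t `<=` G t.+1.
Variable alpha : nat -> R.
Hypothesis alpha_gt0 : forall t, 0 < alpha t.
Hypothesis alpha_decr : forall t, alpha t.+1 <= alpha t.
Hypothesis alpha_sum : series alpha @ \oo --> +oo.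
Variable V : R.
Hypothesis alpha_V : forall k, \sum_(0 <= t < k) alpha t ^+ 2 <= V.
Variables (A : 'M[R]_n) (c : R).
Hypothesis c0 : 0 < c.
Hypothesis A_diss : forall z, c * sqnorm (A *m z) <= - dot z (A *m z).
Variables (M N : nat -> Omega -> 'M[R]_n) (C : R).
Hypothesis MC : forall t w, `|M t w| <= C.
Hypothesis NC : forall t w, `|N t w| <= C.
Hypothesis N_adapted : forall t i j, sbmf G t (fun w => N t w i j).
Hypothesis M_mart : forall i j, martingale_diff P G (fun t w => M t w i j).
Variable u0 : 'cV[R]_n.

Let B t w := A + M t w + N t w - N t.+1 w.

Fixpoint sa_iter (t : nat) (w : Omega) : 'cV[R]_n :=
  if t is t'.+1 then
    sa_iter t' w + alpha t' *:
      ((A + M t' w + N t' w - N t'.+1 w) *m sa_iter t' w)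
  else u0.

Local Notation u := sa_iter.

Let P1 : P setT = 1%E. Proof. exact: probability_setT. Qed.

Let uS t w : u t.+1 w = u t w + alpha t *: (B t w *m u t w).
Proof. by []. Qed.

Let C0 : 0 <= C. Proof. exact: le_trans (NC 0 point). Qed.

Let C' := `|A| + 3 * C.

Let C'0 : 0 <= C'. Proof. by rewrite addr_ge0// mulr_ge0. Qed.

Let BC t w : `|B t w| <= C'.
Proof.
apply: le_trans (ler_normB _ _) _; apply: le_trans (lerD (ler_normD _ _) (NC _ _)) _.
apply: le_trans (lerD (lerD (ler_normD _ _) (NC _ _)) (lexx _)) _.
by have := MC t w; rewrite /C'; lra.
Qed.

Let B_adapted t i j : sbmf G t.+1 (fun w => B t w i j).
Proof.
rewrite /B; under eq_fun do rewrite !mxE.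
apply: bmfB; last exact: N_adapted.
apply: bmfD; last exact: sbmfS.
by apply: bmfD; [exact: bmf_cst|exact: (M_mart i j).1].
Qed.

Let u_adapted t i : sbmf G t (fun w => u t w i 0).
Proof.
elim: t i => [|t IH] i; first exact: bmf_cst.
under eq_fun do rewrite uS mxE [X in _ + X]mxE.
apply: bmfD; first exact: (sbmfS GS (IH i)).
apply: bmfZ; apply: bmf_mulmx => [k l|k]; first exact: B_adapted.
exact: (sbmfS GS (IH k)).
Qed.

Let bu t i : bmf (fun w => u t w i 0).
Proof. exact: (sbmfW GP (u_adapted t i)). Qed.

Let bA (D : 'M[R]_n) t i : bmf (fun w => (D *m u t w) i 0).
Proof. by apply: bmf_mulmx => // k l; exact: bmf_cst. Qed.

Let bM t i : bmf (fun w => (M t w *m u t w) i 0).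
Proof. by apply: bmf_mulmx => // k l; exact: (sbmfW GP ((M_mart k l).1 t)). Qed.

Let bN t i : bmf (fun w => (N t w *m u t w) i 0).
Proof. by apply: bmf_mulmx => // k l; exact: (sbmfW GP (N_adapted t k l)). Qed.

Let y t := \int[P]_w sqnorm (u t w).
Let f t := \int[P]_w (- dot (u t w) (A *m u t w)).
Let Q t := \int[P]_w dot (u t w) (N t w *m u t w).
Let h t := \int[P]_w sqnorm (A *m u t w).

Let by_ t : bmf (fun w => sqnorm (u t w)). Proof. exact: bmf_sqnorm. Qed.
Let bf t : bmf (fun w => dot (u t w) (A *m u t w)). Proof. exact: bmf_dot. Qed.
Let bQ t : bmf (fun w => dot (u t w) (N t w *m u t w)). Proof. exact: bmf_dot. Qed.
Let bh t : bmf (fun w => sqnorm (A *m u t w)). Proof. exact: bmf_sqnorm. Qed.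
Let bMM t : bmf (fun w => dot (u t w) (M t w *m u t w)). Proof. exact: bmf_dot. Qed.

(** The entries of [u t] are known at time [t], so [F] times such an entry is again an admissible
    test function for [M_mart]. *)
Let int_M t F i : sbmf G t F -> \int[P]_w (F w * (M t w *m u t w) i 0) = 0.
Proof.
move=> sF; under eq_Rintegral do rewrite mxE mulr_sumr.
rewrite bmf_int_sum//; last first.
  move=> j; apply: bmfM; first exact: (sbmfW GP sF).
  by apply: bmfM => //; exact: (sbmfW GP ((M_mart i j).1 t)).
apply: big1 => j _; rewrite -[RHS]((M_mart i j).2 t (fun w => F w * u t w j 0)).
  by apply: eq_Rintegral => w _; rewrite mulrAC mulrA.
exact: (bmfM sF (u_adapted t j)).
Qed.

Let int_dot_M t : \int[P]_w dot (u t w) (M t w *m u t w) = 0.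
Proof.
under eq_Rintegral do rewrite dotE.
rewrite bmf_int_sum//; last by move=> i; exact: bmfM.
by apply: big1 => i _; exact: int_M.
Qed.

Let nC := n%:R * C'.
Let nC0 : 0 <= nC. Proof. by rewrite mulr_ge0. Qed.

Let step_le t w : `|u t.+1 w - u t w| <= alpha t * (nC * `|u t w|).
Proof.
rewrite uS [X in `|X|]addrC addKr normrZ gtr0_norm// ler_wpM2l ?(ltW (alpha_gt0 t))//.
by apply: le_trans (norm_mulmx _ _) _; rewrite ler_wpM2r// ler_wpM2l.
Qed.

(** A bilinear form with [N] costs [n%:R * nC] and a step costs [alpha t * nC]; the middle factor
    adds 1 for the old iterate to [1 + alpha 0 * nC] for the updated one. *)
Let K1 := n%:R * nC * (2 + alpha 0 * nC) * nC.

Let alpha_le0 t : alpha t <= alpha 0.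
Proof. by elim: t => // t; apply: le_trans. Qed.

(* Turns the drift of [N t - N t.+1] into a telescoping term. *)
Let quad_shift t w :
  dot (u t.+1 w) (N t.+1 w *m u t.+1 w) - dot (u t w) (N t.+1 w *m u t w)
    <= alpha t * K1 * sqnorm (u t w).
Proof.
have -> : dot (u t.+1 w) (N t.+1 w *m u t.+1 w) - dot (u t w) (N t.+1 w *m u t w)
  = dot (u t.+1 w) (N t.+1 w *m (u t.+1 w - u t w))
    + dot (u t.+1 w - u t w) (N t.+1 w *m u t w).
  by rewrite mulmxBr dotDr dotNr dotDl dotNl; ring.
set dl := u t.+1 w - u t w; set a := `|u t w|.
have a0 : 0 <= a by exact: normr_ge0.
have da : `|dl| <= alpha t * (nC * a) := step_le t w.
have u1 : `|u t.+1 w| <= (1 + alpha 0 * nC) * a.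
  rewrite -(subrK (u t w) (u t.+1 w)) -/dl; apply: le_trans (ler_normD _ _) _.
  have : alpha t * (nC * a) <= alpha 0 * (nC * a).
    by rewrite ler_wpM2r// mulr_ge0.
  move=> H; apply: le_trans (lerD da (lexx _)) _.
  by rewrite -/a mulrDl mul1r -mulrA addrC lerD2l.
have CC' : C <= C' by rewrite /C'; have := C0; have := normr_ge0 A; lra.
have Nv (v : 'cV[R]_n) : `|N t.+1 w *m v| <= nC * `|v|.
  apply: le_trans (norm_mulmx _ _) _; rewrite ler_wpM2r// ler_wpM2l//.
  exact: le_trans CC'.
have dn (v z : 'cV[R]_n) : dot v (N t.+1 w *m z) <= n%:R * nC * (`|v| * `|z|).
  apply: le_trans (ler_norm _) _; apply: le_trans (norm_dot _ _) _.
  rewrite [leRHS](_ : _ = n%:R * `|v| * (nC * `|z|)); last by ring.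
  by rewrite ler_wpM2l ?mulr_ge0// Nv.
apply: (@le_trans _ _ (alpha t * K1 * a ^+ 2)); last first.
  rewrite ler_wpM2l ?norm_le_sqnorm//.
  by rewrite /K1 !mulr_ge0 ?addr_ge0 ?mulr_ge0// ltW.
have nn0 : 0 <= n%:R * nC by rewrite mulr_ge0.
apply: le_trans (lerD (dn _ _) (dn _ _)) _; rewrite -mulrDr -/a.
have -> : alpha t * K1 * a ^+ 2 =
    n%:R * nC * (alpha t * (2 + alpha 0 * nC) * nC * a ^+ 2).
  by rewrite /K1; ring.
rewrite ler_wpM2l//.
apply: (@le_trans _ _ ((1 + alpha 0 * nC) * a * (alpha t * (nC * a))
    + alpha t * (nC * a) * a)).
  by apply: lerD; [exact: ler_pM|rewrite ler_wpM2r].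
by rewrite le_eqVlt; apply/orP; left; apply/eqP; ring.
Qed.

Let K2 := 2 * K1 + n%:R * nC ^+ 2.

Let K20 : 0 <= K2.
Proof.
rewrite /K2 /K1 !addr_ge0 ?mulr_ge0 ?addr_ge0 ?mulr_ge0 ?sqr_ge0//.
all: by rewrite ltW.
Qed.

(** Expand the square of the update. The form of [N t.+1] at [u t] is moved to [u t.+1] by
    [quad_shift], and its error joins the square of the step in [K2]. *)
Let pointwise_step t w : sqnorm (u t.+1 w) <= sqnorm (u t w)
   + 2 * alpha t * (dot (u t w) (A *m u t w) + dot (u t w) (M t w *m u t w)
     + dot (u t w) (N t w *m u t w) - dot (u t.+1 w) (N t.+1 w *m u t.+1 w))
   + K2 * alpha t ^+ 2 * sqnorm (u t w).
Proof.
have a0 := alpha_gt0 t.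
have E : sqnorm (u t.+1 w) = sqnorm (u t w) + 2 * alpha t * dot (u t w) (B t w *m u t w)
    + alpha t ^+ 2 * sqnorm (B t w *m u t w).
  rewrite !sqnormE uS dotDl !dotDr !dotZl !dotZr (dotC (B t w *m u t w) (u t w)).
  by ring.
have S : sqnorm (B t w *m u t w) <= n%:R * nC ^+ 2 * sqnorm (u t w).
  apply: le_trans (sqnorm_le _) _; rewrite -mulrA ler_wpM2l//.
  apply: (@le_trans _ _ (nC ^+ 2 * `|u t w| ^+ 2)).
    rewrite -exprMn lerXn2r ?nnegrE ?mulr_ge0//.
    by apply: le_trans (norm_mulmx _ _) _; rewrite ler_wpM2r// ler_wpM2l.
  by rewrite ler_wpM2l ?sqr_ge0// norm_le_sqnorm.
have D : dot (u t w) (B t w *m u t w) = dot (u t w) (A *m u t w)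
    + dot (u t w) (M t w *m u t w) + dot (u t w) (N t w *m u t w)
    - dot (u t w) (N t.+1 w *m u t w).
  by rewrite /B mulmxBl !mulmxDl !dotDr dotNr.
have q := quad_shift t w.
rewrite E D /K2.
have S' : alpha t ^+ 2 * sqnorm (B t w *m u t w)
   <= alpha t ^+ 2 * (n%:R * nC ^+ 2 * sqnorm (u t w)).
  by rewrite ler_wpM2l ?sqr_ge0.
have q' : 2 * alpha t * (dot (u t.+1 w) (N t.+1 w *m u t.+1 w)
     - dot (u t w) (N t.+1 w *m u t w)) <= 2 * alpha t * (alpha t * K1 * sqnorm (u t w)).
  by rewrite ler_wpM2l// mulr_ge0// ltW.
move: S' q'; set X1 := dot _ (A *m _); set X2 := dot _ (M t w *m _).
set X3 := dot _ (N t w *m _); set X4 := dot _ (N t.+1 w *m u t w).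
set X5 := dot _ (N t.+1 w *m _); set X6 := sqnorm (B t w *m _).
set X7 := sqnorm _ => S' q'.
rewrite -subr_ge0.
rewrite [leRHS](_ : _ = (2 * alpha t * (alpha t * K1 * X7) - 2 * alpha t * (X5 - X4))
  + (alpha t ^+ 2 * (n%:R * nC ^+ 2 * X7) - alpha t ^+ 2 * X6)); last by ring.
by rewrite addr_ge0// subr_ge0.
Qed.

Let mean_step t : y t.+1 <= y t - 2 * alpha t * f t
  + 2 * alpha t * (Q t - Q t.+1) + K2 * alpha t ^+ 2 * y t.
Proof.
have bb : bmf (fun w => dot (u t w) (A *m u t w) + dot (u t w) (M t w *m u t w)
     + dot (u t w) (N t w *m u t w) - dot (u t.+1 w) (N t.+1 w *m u t.+1 w)).
  by apply: bmfB => //; apply: bmfD => //; apply: bmfD.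
have b2 := bmfZ (2 * alpha t) bb; have b3 := bmfZ (K2 * alpha t ^+ 2) (by_ t).
apply: (@le_trans _ _ (\int[P]_w (sqnorm (u t w)
   + 2 * alpha t * (dot (u t w) (A *m u t w) + dot (u t w) (M t w *m u t w)
     + dot (u t w) (N t w *m u t w) - dot (u t.+1 w) (N t.+1 w *m u t.+1 w))
   + K2 * alpha t ^+ 2 * sqnorm (u t w)))).
  apply: bmf_int_le; [exact: P1|exact: by_| |exact: pointwise_step].
  by apply: bmfD => //; exact: bmfD.
have bAM : bmf (fun w => dot (u t w) (A *m u t w) + dot (u t w) (M t w *m u t w)).
  exact: bmfD.
rewrite bmf_intD//; last exact: bmfD.
rewrite bmf_intD// !bmf_intZ// bmf_intB//; last exact: bmfD.
rewrite bmf_intD// bmf_intD// int_dot_M addr0.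
have -> : \int[P]_w dot (u t w) (A *m u t w) = - f t.
  rewrite /f; under [in RHS]eq_Rintegral do rewrite -mulN1r.
  by rewrite bmf_intZ// mulN1r opprK.
rewrite -/(y t) -/(Q t) -/(Q t.+1).
by rewrite le_eqVlt; apply/orP; left; apply/eqP; ring.
Qed.

Let h_le_f t : c * h t <= f t.
Proof.
rewrite -bmf_intZ//; apply: bmf_int_le; [exact: P1|exact: bmfZ|exact: bmfN|].
by move=> w; exact: A_diss.
Qed.

Let h0 t : 0 <= h t.
Proof. by apply: Rintegral_ge0 => w _; exact: sqnorm_ge0. Qed.

Let y0 t : 0 <= y t.
Proof. by apply: Rintegral_ge0 => w _; exact: sqnorm_ge0. Qed.

Let f0 t : 0 <= f t.
Proof. by apply: le_trans (h_le_f t); rewrite mulr_ge0// ltW. Qed.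

(** [lyapunov_bounded] uses one constant for [Q] and for the quadratic error, hence the added
    [K2]. *)
Let Q_le t : `|Q t| <= (K2 + n%:R * nC) * y t.
Proof.
have CC' : C <= C' by rewrite /C'; have := C0; have := normr_ge0 A; lra.
apply: (@le_trans _ _ (n%:R * nC * y t)); last first.
  by rewrite ler_wpM2r// lerDr.
apply: le_trans (le_normr_Rintegral _ _) _ => //; first exact: bmf_integrable.
rewrite -bmf_intZ//; apply: bmf_int_le => //.
- by case: (bQ t) => m [D HD]; split; [exact: measurableT_comp|
    exists D => w; rewrite normr_id].
- exact: bmfZ.
move=> w; apply: le_trans (norm_dot _ _) _.
apply: (@le_trans _ _ (n%:R * `|u t w| * (nC * `|u t w|))).
  rewrite ler_wpM2l ?mulr_ge0//.
  apply: le_trans (norm_mulmx _ _) _; rewrite ler_wpM2r// ler_wpM2l//.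
  exact: le_trans CC'.
rewrite [leLHS](_ : _ = n%:R * nC * `|u t w| ^+ 2); last by ring.
by rewrite ler_wpM2l ?mulr_ge0// norm_le_sqnorm.
Qed.

Let L2_bounded : exists K, (forall t, y t <= K) /\
  forall k, \sum_(0 <= t < k) alpha t * f t <= K.
Proof.
have KK : 0 <= K2 + n%:R * nC by rewrite addr_ge0// mulr_ge0.
apply: (lyapunov_bounded alpha_gt0 alpha_decr alpha_V KK y0 f0 Q_le) => t.
apply: le_trans (mean_step t) _; rewrite lerD2l ler_wpM2r//.
by rewrite ler_wpM2r ?sqr_ge0// lerDl mulr_ge0.
Qed.

(** Bounded second moments of [u] make the variance of each increment of order [alpha t ^+ 2], which
    is summable. *)
Let M_cauchy K : (forall t, y t <= K) -> forall i,
  \forall w \ae P, forall e : R, 0 < e -> exists m, forall k, (m <= k)%N ->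
    `|\sum_(m <= t < k) alpha t * (M t w *m u t w) i 0| < e.
Proof.
move=> yK i; have K0 : 0 <= K by exact: le_trans (yK 0).
pose xi t w := alpha t * (M t w *m u t w) i 0.
have xiM : martingale_diff P G xi.
  split=> [t|t F sF].
    apply: bmfZ; apply: bmf_mulmx => [k l|k]; first exact: (M_mart k l).1.
    exact: (sbmfS GS (u_adapted t k)).
  under eq_Rintegral do rewrite mulrCA.
  rewrite bmf_intZ// ?int_M ?mulr0//.
  by apply: bmfM => //; exact: (sbmfW GP sF).
apply: (@martingale_cauchy _ _ _ P G GP GS xi
  (fun t => alpha t ^+ 2 * ((n%:R * C) ^+ 2 * K)) (V * ((n%:R * C) ^+ 2 * K))) => //.
- move=> t; under eq_Rintegral do rewrite /xi exprMn.
  rewrite bmf_intZ//; last exact: bmf_sqr.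
  rewrite ler_wpM2l ?sqr_ge0//; apply: (@le_trans _ _ ((n%:R * C) ^+ 2 * y t)).
    rewrite -bmf_intZ//; apply: bmf_int_le => //; [exact: bmf_sqr|exact: bmfZ|].
    move=> w; apply: (@le_trans _ _ ((n%:R * C) ^+ 2 * `|u t w| ^+ 2)).
      rewrite -exprMn -real_normK ?num_real// lerXn2r ?nnegrE ?mulr_ge0//.
      apply: le_trans (mx_entry_le_norm _ _ _) _.
      by apply: le_trans (norm_mulmx _ _) _; rewrite ler_wpM2r// ler_wpM2l.
    by rewrite ler_wpM2l ?sqr_ge0// norm_le_sqnorm.
  by rewrite ler_wpM2l ?sqr_ge0.
- move=> k; rewrite -mulr_suml; apply: ler_wpM2r; last exact: alpha_V.
  by rewrite mulr_ge0// sqr_ge0.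
Qed.

Theorem stochastic_approximation : \forall w \ae P,
  exists (sk : nat -> nat) (l : 'cV[R]_n),
    [/\ {homo sk : i j / (i < j)%N}, (fun k => u (sk k) w) @ \oo --> l,
        A *m l = 0 &
        forall T e : R, 0 < T -> 0 < e -> \forall k \near \oo, forall j,
          (sk k <= j)%N -> \sum_(sk k <= t < j) alpha t <= T ->
          `|u j w - l| <= e].
Proof.
have [K [yK fK]] := L2_bounded; have K0 : 0 <= K by exact: le_trans (yK 0).
have hK k : \sum_(0 <= t < k) alpha t * h t <= K / c.
  rewrite ler_pdivlMr// mulrC mulr_sumr; apply: le_trans (fK k).
  apply: ler_sum => t _; rewrite mulrCA ler_wpM2l ?(ltW (alpha_gt0 t))//.
pose g t w := alpha t * sqnorm (A *m u t w) + alpha t ^+ 2 * sqnorm (u t w)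
  + (alpha t - alpha t.+1) * sqnorm (u t.+1 w).
have g_ge0 t w : 0 <= g t w.
  rewrite /g !addr_ge0// mulr_ge0 ?sqnorm_ge0 ?sqr_ge0 ?subr_ge0//.
  exact: ltW.
have bg t : bmf (g t).
  by apply: bmfD; [apply: bmfD|]; exact: bmfZ.
(* The three terms come from the dissipated drift, the summable squared steps and the telescoping
   decrease of [alpha]. *)
have gK k : \sum_(0 <= t < k) \int[P]_w g t w <= K / c + V * K + alpha 0 * K.
  have -> : \sum_(0 <= t < k) \int[P]_w g t w = \sum_(0 <= t < k)
     (alpha t * h t + alpha t ^+ 2 * y t + (alpha t - alpha t.+1) * y t.+1).
    apply: eq_bigr => t _; rewrite bmf_intD//; [|by apply: bmfD; exact: bmfZ|exact: bmfZ].
    by rewrite bmf_intD//; [|exact: bmfZ|exact: bmfZ]; rewrite !bmf_intZ.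
  rewrite big_split/= [X in X + _ <= _]big_split/=; apply: lerD; first apply: lerD => //.
    apply: (@le_trans _ _ (\sum_(0 <= t < k) alpha t ^+ 2 * K)).
      by apply: ler_sum => t _; rewrite ler_wpM2l// sqr_ge0.
    by rewrite -mulr_suml ler_wpM2r.
  apply: (@le_trans _ _ (\sum_(0 <= t < k) (alpha t - alpha t.+1) * K)).
    by apply: ler_sum => t _; rewrite ler_wpM2l// subr_ge0.
  rewrite -mulr_suml ler_wpM2r//.
  have -> : \sum_(0 <= t < k) (alpha t - alpha t.+1) = alpha 0 - alpha k.
    rewrite -[RHS]opprB -telescope_sumr// -sumrN.
    by apply: eq_bigr => t _; rewrite opprB.
  by rewrite gerBl ltW.
have half k : 0 < (2 : R)^-1 ^+ k by rewrite exprn_gt0// invr_gt0.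
(* The times depend on expectations only, so they are common to all sample points. *)
have [tk [tkS tkh]] := @extract_subseq (fun k m => h m <= 2^-1 ^+ k)
  (fun k m => frequently_small alpha_gt0 alpha_sum hK h0 m
     (half k)).
have tkh' k : \sum_(0 <= i < k) h (tk i) <= 2.
  (* The exact geometric sum is the bound that passes through the induction. *)
  apply: (@le_trans _ _ (2 - 2 * 2^-1 ^+ k)); last by rewrite gerBl mulr_ge0// exprn_ge0.
  elim: k => [|k IH]; first by rewrite big_geq// expr0 mulr1 subrr.
  rewrite big_nat_recr//= exprS; have := tkh k; lra.
have ae1 := ae_sum_bounded bg g_ge0 gK.
have ae2 := @ae_sum_bounded _ _ _ P (fun k w => sqnorm (A *m u (tk k) w)) 2
  (fun k => bh (tk k)) (fun k w => sqnorm_ge0 _) tkh'.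
have ae3 := @ae_frequently_bounded _ _ _ P (fun k w => sqnorm (u (tk k) w)) K
  (fun k => by_ (tk k)) (fun k w => sqnorm_ge0 _) (fun k => yK (tk k)).
have ae4 : \forall w \ae P, forall i (e : R), 0 < e -> exists m, forall k, (m <= k)%N ->
    `|\sum_(m <= t < k) alpha t * (M t w *m u t w) i 0| < e.
  by apply: filter_forall => i; exact: (M_cauchy yK).
apply: filterS3 (filterI ae1 ae2) ae3 ae4 => w [[W gW] [U hU]] [L uL] Mw.
have NC' t : `|N t w| <= C'.
  by apply: le_trans (NC t w) _; rewrite /C'; have := C0; have := normr_ge0 A; lra.
apply: (@subsequence_window _ n alpha alpha_gt0 alpha_decr V alpha_V A
  (M ^~ w) (N ^~ w) (u ^~ w) C' NC' (BC ^~ w) (uS ^~ w) W gW Mw tk U L tkS hU uL).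
Qed.

End stochastic_approximation.

(** * The mean field of linear TD *)

Lemma measurable_coord {R : realType} n (i : 'I_n) :
  measurable_fun setT (fun v : g_sigma_algebraType (@open 'cV[R]_n) => v i 0).
Proof.
apply: (measurability _ (RGenOInfty.measurableE R)) => _ /= [_ [a ->] <-].
rewrite setTI; apply: sub_sigma_algebra.
rewrite (_ : _ @^-1` _ = (fun v : 'cV[R]_n => v i 0) @^-1` [set z | a < z]).
  by apply: open_comp => [v _|]; [exact: coord_continuous|exact: open_gt].
by apply/seteqP; split => v /=; rewrite in_itv/= andbT.
Qed.

Lemma borel_fun_coord {R : realType} d (T : measurableType d) n (D : set T)
  (f : T -> 'cV[R]_n) i : borel_fun D f -> measurable_fun D (fun s => f s i 0).
Proof. by move=> mf; exact: (measurableT_comp (measurable_coord i) mf). Qed.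

Lemma enorm_sqr {R : realType} n (v : 'cV[R]_n) : enorm v ^+ 2 = sqnorm v.
Proof. by rewrite sqr_sqrtr// sqnorm_ge0. Qed.

Lemma norm_le_enorm {R : realType} n (v : 'cV[R]_n) : `|v| <= enorm v.
Proof.
by rewrite -(@ler_pXn2r _ 2)// ?nnegrE ?sqrtr_ge0// enorm_sqr norm_le_sqnorm.
Qed.

Lemma enorm_le_norm {R : realType} n (v : 'cV[R]_n) :
  enorm v <= (1 + n%:R) * `|v|.
Proof.
rewrite -(@ler_pXn2r _ 2)// ?nnegrE ?sqrtr_ge0 ?mulr_ge0 ?addr_ge0//.
rewrite enorm_sqr (le_trans (sqnorm_le v))// exprMn ler_wpM2r ?sqr_ge0//.
by have : 0 <= n%:R :> R by []; nra.
Qed.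

Section mean_field.
Context {R : realType} d (T : measurableType d) (n : nat).
Variables (p : R.-pker T ~> T) (mu : probability T R).
Hypothesis mu_stat : stationary p mu.
Variables (r : T -> R) (gamma : R) (x : T -> 'cV[R]_n) (Mx Mr : R).
Hypothesis gamma01 : 0 <= gamma < 1.
Hypothesis mr : measurable_fun setT r.
Hypothesis mx : borel_fun setT x.
Hypothesis xM : forall s, enorm (x s) <= Mx.
Hypothesis rM : forall s, `|r s| <= Mr.

Let eta := pair_law p mu.

Let eta_rect A B : measurable A -> measurable B ->
  eta (A `*` B) = (\int[mu]_(s in A) p s B)%E.
Proof.
move=> mA mB; rewrite [RHS]integral_mkcond; apply: eq_integral => s _.
rewrite patchE; case: ifPn => sA; first by rewrite in_xsectionX.
by rewrite notin_xsectionX// measure0.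
Qed.

Let eta1 : eta setT = 1%E. Proof. exact: (disintegration1 eta_rect). Qed.

Let mu1 : mu setT = 1%E. Proof. exact: probability_setT. Qed.

Let eta_int (G : T * T -> R) : bmf G ->
  \int[eta]_y G y = \int[mu]_s \int[p s]_s' G (s, s').
Proof. exact: (disintegration eta_rect). Qed.

Let bmf_fst (f : T -> R) : bmf f -> bmf (fun y : T * T => f y.1).
Proof. by move=> bf; apply: (bmf_comp bf). Qed.

Let bmf_snd (f : T -> R) : bmf f -> bmf (fun y : T * T => f y.2).
Proof. by move=> bf; apply: (bmf_comp bf). Qed.

Let eta_fst (f : T -> R) : bmf f -> \int[eta]_y f y.1 = \int[mu]_s f s.
Proof.
move=> bf; rewrite eta_int; last exact: bmf_fst.
apply: eq_Rintegral => s _ /=; rewrite bmf_int_cst//; exact: prob_kernel.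
Qed.

(** Stationarity enters here: it makes [mu] the second marginal of [eta] as well. *)
Let eta_snd (f : T -> R) : bmf f -> \int[eta]_y f y.2 = \int[mu]_s f s.
Proof.
move=> bf; have bf2 := bmf_snd bf.
rewrite /Rintegral; congr fine.
rewrite [RHS](eq_measure_integral (pushforward eta snd)); last first.
  move=> Z mZ _; have E : (snd : T * T -> T) @^-1` Z = setT `*` Z.
    by apply/seteqP; split => -[s s'] //= [].
  have H : mu Z = eta (snd @^-1` Z) by rewrite E eta_rect// mu_stat.
  exact: H.
rewrite integral_pushforward//; last first.
- by apply: bmf_integrable.
- by apply/measurable_EFinP; case: bf.
Qed.

Lemma bmf_feature i : bmf (fun s => x s i 0).
Proof.
split; first exact: (borel_fun_coord i mx).
exists Mx => s; apply: le_trans (xM s); apply: le_trans (norm_le_enorm _).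
exact: mx_entry_le_norm.
Qed.

Let br : bmf r. Proof. by split => //; exists Mr. Qed.

(** The linear part of [td_H] in [w]; its mean under [eta] is [td_A]. *)
Definition td_rate (y : T * T) : 'M[R]_n :=
  x y.1 *m (gamma *: (x y.2)^T - (x y.1)^T).

Let td_rateE y i j :
  td_rate y i j = x y.1 i 0 * (gamma * x y.2 j 0 - x y.1 j 0).
Proof. by rewrite mxE big_ord1 !mxE. Qed.

Lemma bmf_td_rate i j : bmf (fun y => td_rate y i j).
Proof.
under eq_fun do rewrite td_rateE.
have b1 k := bmf_fst (bmf_feature k); have b2 k := bmf_snd (bmf_feature k).
by apply: bmfM => //; apply: bmfB => //; exact: bmfZ.
Qed.

Lemma td_HE w y :
  td_H r gamma x w y = td_rate y *m w + r y.1 *: x y.1.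
Proof.
rewrite /td_H /td_rate -mulmxA mulmxBl -scalemxAl.
have E (v : 'cV[R]_n) : v^T *m w = (dot w v)%:M.
  by apply/matrixP => a b; rewrite !ord1 [RHS]mxE eqxx mulr1n -/(dot v w) dotC.
rewrite !E; apply/matrixP => i j; rewrite !mxE big_ord1 !mxE (ord1 j) eqxx !mulr1n.
ring.
Qed.

Let AE i j : td_A p mu gamma x i j = \int[eta]_y td_rate y i j.
Proof.
rewrite eta_int; last exact: bmf_td_rate.
rewrite mxE; apply: eq_Rintegral => s _.
under [RHS]eq_Rintegral do rewrite td_rateE/=.
have ps1 : p s setT = 1%E by exact: prob_kernel.
have bj := bmf_feature j; have bgj := bmfZ gamma bj.
rewrite bmf_intZ//; last by apply: bmfB => //; exact: bmf_cst.
rewrite bmf_intB//; last exact: bmf_cst.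
rewrite bmf_intZ// bmf_int_cst// mxE big_ord1 !mxE.
by congr (_ * (_ * _ - _)); apply: eq_Rintegral => s' _; rewrite mxE.
Qed.

Let bE i : td_b mu r x i 0 = \int[mu]_s (r s * x s i 0).
Proof. by rewrite mxE; apply: eq_Rintegral => s _; rewrite mxE. Qed.

Lemma td_hE w : td_h p mu r gamma x w = td_A p mu gamma x *m w + td_b mu r x.
Proof.
apply/matrixP => i j; rewrite (ord1 j) [LHS]mxE [RHS]mxE [X in _ = X + _]mxE bE.
under eq_Rintegral do rewrite td_HE mxE [X in X + _]mxE [X in _ + X]mxE.
have b1 k : bmf (fun y => td_rate y i k * w k 0).
  by apply: bmfM; [exact: bmf_td_rate|exact: bmf_cst].
have brx : bmf (fun s => r s * x s i 0) by apply: bmfM => //; exact: bmf_feature.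
rewrite bmf_intD//; [|exact: bmf_sum|exact: (bmf_fst brx)].
rewrite (eta_fst brx) bmf_int_sum//; congr (_ + _); apply: eq_bigr => k _.
rewrite AE mulrC -bmf_intZ//; last exact: bmf_td_rate.
by apply: eq_Rintegral => y _; rewrite mulrC.
Qed.

(** * The mean matrix in one fixed direction [z] *)

Section direction.
Variable z : 'cV[R]_n.
Let g s := dot z (x s).
Let J := \int[mu]_s (g s ^+ 2).

Let bg : bmf g.
Proof.
rewrite /g; under eq_fun do rewrite dotE.
by apply: bmf_sum => i; apply: bmfZ; exact: bmf_feature.
Qed.

Let bg1 := bmf_fst bg.
Let bg2 := bmf_snd bg.
Let bgg1 := bmf_fst (bmf_sqr bg).
Let bgg2 := bmf_snd (bmf_sqr bg).

Let AzE i : (td_A p mu gamma x *m z) i 0 =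
  \int[eta]_y (x y.1 i 0 * (gamma * g y.2 - g y.1)).
Proof.
rewrite mxE; transitivity (\sum_j \int[eta]_y (z j 0 * td_rate y i j)).
  by apply: eq_bigr => j _; rewrite AE bmf_intZ// 1?mulrC//; exact: bmf_td_rate.
rewrite -bmf_int_sum//; last by move=> j; apply: bmfZ; exact: bmf_td_rate.
apply: eq_Rintegral => y _; rewrite /g !dotE !mulr_sumr -sumrB mulr_sumr.
by apply: eq_bigr => j _; rewrite td_rateE; ring.
Qed.

Let J0 : 0 <= J. Proof. by apply: Rintegral_ge0 => s _; exact: sqr_ge0. Qed.

(** Bound [g y.1 * g y.2] by half the sum of the squares; as both marginals of [eta] are [mu], each
    square integrates to [J]. *)
Lemma td_A_form_le :
  dot z (td_A p mu gamma x *m z) <= (gamma - 1) * \int[mu]_s (dot z (x s) ^+ 2).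
Proof.
have /andP[g0 g1] := gamma01.
have bd : bmf (fun y : T * T => gamma * g y.2 - g y.1).
  by apply: bmfB => //; exact: bmfZ.
have -> : dot z (td_A p mu gamma x *m z) =
    \int[eta]_y (g y.1 * (gamma * g y.2 - g y.1)).
  rewrite dotE; transitivity (\sum_i \int[eta]_y
      (z i 0 * (x y.1 i 0 * (gamma * g y.2 - g y.1)))).
    apply: eq_bigr => i _; rewrite AzE bmf_intZ//.
    by apply: bmfM => //; exact: (bmf_fst (bmf_feature i)).
  rewrite -bmf_int_sum//; last first.
    move=> i; apply: bmfZ; apply: bmfM => //; exact: (bmf_fst (bmf_feature i)).
  apply: eq_Rintegral => y _.
  transitivity (dot z (x y.1) * (gamma * g y.2 - g y.1)) => //.
  rewrite dotE mulr_suml.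
  by apply: eq_bigr => j _; rewrite mulrA.
apply: (@le_trans _ _ (\int[eta]_y ((gamma / 2 - 1) * g y.1 ^+ 2
    + gamma / 2 * g y.2 ^+ 2))).
  apply: bmf_int_le => //; first exact: bmfM.
    by apply: bmfD; exact: bmfZ.
  move=> y; have := sqr_ge0 (g y.1 - g y.2); nra.
rewrite bmf_intD// ?bmf_intZ//; [|exact: bmfZ|exact: bmfZ].
rewrite (eta_fst (bmf_sqr bg)) (eta_snd (bmf_sqr bg)) -/(g _) -/J.
rewrite le_eqVlt; apply/orP; left; apply/eqP; rewrite -mulrDl; congr (_ * _).
by field.
Qed.

(** Jensen in each coordinate. The 4 is a 2 from the square of a difference times the two equal
    marginals; the right-hand integral is the one of [td_A_form_le]. *)
Lemma sqnorm_td_A_le :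
  sqnorm (td_A p mu gamma x *m z)
    <= n%:R * (4 * Mx ^+ 2) * \int[mu]_s (dot z (x s) ^+ 2).
Proof.
have /andP[g0 g1] := gamma01.
have bd : bmf (fun y : T * T => gamma * g y.2 - g y.1).
  by apply: bmfB => //; exact: bmfZ.
rewrite -mulrA; have -> : n%:R = \sum_(i < n) (1 : R) by rewrite sumr_const card_ord.
rewrite mulr_suml; apply: ler_sum => i _; rewrite mul1r AzE.
have bxi := bmf_fst (bmf_feature i).
have bb := bmfM bxi bd.
apply: le_trans (sqr_int_le eta1 bb) _.
apply: (@le_trans _ _ (\int[eta]_y (2 * Mx ^+ 2 * (g y.2 ^+ 2 + g y.1 ^+ 2)))).
  apply: bmf_int_le => //; first exact: bmf_sqr.
    by apply: bmfZ; exact: bmfD.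
  move=> y; rewrite exprMn.
  have xi : x y.1 i 0 ^+ 2 <= Mx ^+ 2.
    rewrite -real_normK ?num_real// lerXn2r ?nnegrE//.
      by apply: le_trans (xM y.1); exact: sqrtr_ge0.
    apply: le_trans (xM y.1); apply: le_trans (norm_le_enorm _).
    exact: mx_entry_le_norm.
  have gg : (gamma * g y.2 - g y.1) ^+ 2 <= 2 * (g y.2 ^+ 2 + g y.1 ^+ 2).
    have h1 := sqr_ge0 (gamma * g y.2 + g y.1).
    have h2 : gamma ^+ 2 * g y.2 ^+ 2 <= 1 * g y.2 ^+ 2.
      by rewrite ler_wpM2r ?sqr_ge0// expr_le1// ltW.
    have -> : (gamma * g y.2 - g y.1) ^+ 2 = 2 * (gamma ^+ 2 * g y.2 ^+ 2 + g y.1 ^+ 2)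
       - (gamma * g y.2 + g y.1) ^+ 2 by ring.
    lra.
  rewrite [leRHS](_ : _ = Mx ^+ 2 * (2 * (g y.2 ^+ 2 + g y.1 ^+ 2))); last by ring.
  by rewrite ler_pM// sqr_ge0.
rewrite bmf_intZ//; last exact: bmfD.
rewrite bmf_intD// (eta_fst (bmf_sqr bg)) (eta_snd (bmf_sqr bg)) -/J.
by rewrite le_eqVlt; apply/orP; left; apply/eqP; ring.
Qed.

(** The reward is bounded, so by Jensen the square of [dot z b] is at most [Mr ^+ 2] times the
    vanishing integral. *)
Lemma dot_td_b0 : \int[mu]_s (dot z (x s) ^+ 2) <= 0 -> dot z (td_b mu r x) = 0.
Proof.
move=> J_le0.
have brg : bmf (fun s => r s * g s) by exact: bmfM.
have -> : dot z (td_b mu r x) = \int[mu]_s (r s * g s).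
  rewrite dotE; transitivity (\sum_i \int[mu]_s (z i 0 * (r s * x s i 0))).
    apply: eq_bigr => i _; rewrite bE bmf_intZ//.
    by apply: bmfM => //; exact: bmf_feature.
  rewrite -bmf_int_sum//; last first.
    by move=> i; apply: bmfZ; apply: bmfM => //; exact: bmf_feature.
  apply: eq_Rintegral => s _; rewrite /g dotE mulr_sumr.
  by apply: eq_bigr => i _; rewrite mulrCA.
apply/eqP; rewrite -sqrf_eq0 eq_le sqr_ge0 andbT.
apply: le_trans (sqr_int_le mu1 brg) _.
have bg' := bmf_sqr bg.
apply: (@le_trans _ _ (\int[mu]_s (Mr ^+ 2 * g s ^+ 2))).
  apply: bmf_int_le => //; [exact: bmf_sqr|exact: bmfZ|].
  move=> s; rewrite exprMn ler_wpM2r ?sqr_ge0//.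
  rewrite -real_normK ?num_real// lerXn2r ?nnegrE//.
  exact: le_trans (rM s).
by rewrite bmf_intZ//; apply: mulr_ge0_le0 => //; exact: sqr_ge0.
Qed.

End direction.

Lemma td_A_dissipative : exists2 c, 0 < c & forall z,
  c * sqnorm (td_A p mu gamma x *m z) <= - dot z (td_A p mu gamma x *m z).
Proof.
have /andP[g0 g1] := gamma01.
(* The added 1 keeps the divisor positive when [n] or [Mx] is zero. *)
pose D := n%:R * (4 * Mx ^+ 2) + 1.
have D0 : 0 < D by rewrite ltr_wpDl// mulr_ge0// mulr_ge0// sqr_ge0.
exists ((1 - gamma) / D) => [|z]; first by rewrite divr_gt0// subr_gt0.
have := td_A_form_le z; have := sqnorm_td_A_le z.
set J := \int[mu]_s _ => h1 h2.
have J0 : 0 <= J by apply: Rintegral_ge0 => s _; exact: sqr_ge0.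
apply: (@le_trans _ _ ((1 - gamma) * J)); last by lra.
rewrite -mulrA ler_wpM2l ?subr_ge0 ?(ltW g1)// ler_pdivrMl//.
by apply: le_trans h1 _; rewrite ler_wpM2r// /D lerDl.
Qed.

(* A vector orthogonal to the range of [td_A] is a direction along which the
   features vanish almost everywhere, so it is also orthogonal to [td_b]. *)
Lemma td_solution_exists : exists w, td_solutions p mu r gamma x w.
Proof.
have /andP[g0 g1] := gamma01.
set A := td_A p mu gamma x; set b := td_b mu r x.
(* Solvability as a row-space inclusion: it is tested on the columns [z] of [cokermx A^T], each of
   which satisfies [A^T *m z = 0]. *)
have : ((- b)^T <= A^T)%MS.
  rewrite submxE; apply/eqP/matrixP => i j; rewrite (ord1 i) [RHS]mxE.
  set z := col j (cokermx A^T).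
  have Az : A^T *m z = 0 by rewrite /z colE mulmxA mulmx_coker mul0mx.
  have zA : dot z (A *m z) = 0.
    by rewrite /dot mulmxA -[z^T *m A]trmxK trmx_mul trmxK Az trmx0 mul0mx mxE.
  have Jz : \int[mu]_s (dot z (x s) ^+ 2) <= 0.
    have := td_A_form_le z; rewrite -/A zA.
    set J := \int[mu]_s _ => h; rewrite -(@pmulr_rle0 _ (1 - gamma)) ?subr_gt0//.
    lra.
  have := dot_td_b0 Jz; rewrite -/b dotC /dot => bz.
  have -> : ((- b)^T *m cokermx A^T) 0 j = ((- b)^T *m z) 0 0.
    rewrite [LHS]mxE [RHS]mxE; apply: eq_bigr => k _; congr (_ * _).
    by rewrite /z [RHS]mxE.
  by rewrite linearN/= mulNmx mxE bz oppr0.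
case/submxP => D /(congr1 trmx); rewrite trmx_mul !trmxK => bD.
by exists D^T; rewrite /td_solutions/= -/A -/b -bD addNr.
Qed.

End mean_field.

(** * Convergence of linear TD along a subsequence *)

Lemma sum_le_horizon {R : realType} (alpha : nat -> R) (t j : nat) (T : R) :
    (forall i, 0 < alpha i) -> 0 < T -> (t <= j)%N ->
    (j < (horizon alpha t T).+1)%N ->
  \sum_(t <= i < j) alpha i <= T.
Proof.
move=> a0 T0 tj; rewrite ltnS /horizon; case: xgetP => [N -> [/= AN _]|_] jN.
  apply: le_trans AN; rewrite [leRHS](@big_cat_nat _ _ _ j)//=; last exact: leqW.
  by rewrite lerDl; apply: sumr_ge0 => i _; exact: ltW.
(* With the default value 0 of [horizon], the index [j] is 0 and the sum is empty. *)
move: jN; rewrite leqn0 => /eqP j0; rewrite j0 in tj *.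
by rewrite big_geq// ltW.
Qed.

Section td_convergence.
Context {R : realType} d (T : measurableType d) (n : nat).
Variables (p : R.-pker T ~> T) (mu : probability T R).
Context d' (Omega : measurableType d') (P : probability Omega R).
Variable X : nat -> {RV P >-> T}.
Hypothesis markovX : markov_chain p P X.
Hypothesis mu_stat : stationary p mu.
Variables (r : T -> R) (gamma : R) (x : T -> 'cV[R]_n) (Mx Mr : R).
Hypothesis gamma01 : 0 <= gamma < 1.
Hypothesis mr : measurable_fun setT r.
Hypothesis mx : borel_fun setT x.
Hypothesis xM : forall s, enorm (x s) <= Mx.
Hypothesis rM : forall s, `|r s| <= Mr.
Variables (w0 : 'cV[R]_n) (alpha : nat -> R) (Y : set (T * T)).
Hypothesis mY : measurable Y.
Hypothesis Y_chain : \forall omega \ae P, forall t, Y (X t omega, X t.+1 omega).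
Hypothesis alpha_gt0 : forall t, 0 < alpha t.
Hypothesis alpha_decr : forall t, alpha t.+1 <= alpha t.
Hypothesis alpha_sum : series alpha @ \oo --> +oo.
Hypothesis alpha_sum2 : cvgn (series (fun t => alpha t ^+ 2)).
Variable nu : 'cV[R]_n -> T * T -> 'cV[R]_n.
Hypothesis mnu : forall w, borel_fun Y (nu w).
Hypothesis nu_poisson : forall w y, Y y ->
  nu w y - pair_kernel_app p Y (nu w) y
    = td_H r gamma x w y - td_h p mu r gamma x w.
Hypothesis nu_bnd : forall w, exists C, forall y, Y y -> `|nu w y| <= C.

(** Extension by zero makes the Poisson solution measurable on the whole product and turns integrals
    over [Y] into integrals over the whole space. *)
Let pn w y := if y \in Y then nu w y else 0.

Let bpn w i : bmf (fun y => pn w y i 0).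
Proof.
split.
  have /(measurable_restrictT _ mY) := borel_fun_coord i (mnu w).
  congr measurable_fun; apply/funext => y; rewrite patchE /pn.
  by case: ifPn => // _; rewrite mxE.
have [C HC] := nu_bnd w; exists `|C| => y; rewrite /pn; case: ifPn => yY.
  apply: le_trans (mx_entry_le_norm _ _ _) _.
  by apply: le_trans (HC y (set_mem yY)) _; exact: ler_norm.
by rewrite mxE normr0.
Qed.

Let bpn_slice w i s : bmf (fun s' => pn w (s, s') i 0).
Proof. by apply: (bmf_comp (bpn w i)); exact: pair1_measurable. Qed.

Let pn_poisson w y i : Y y ->
  pn w y i 0 - \int[p y.2]_s pn w (y.2, s) i 0
    = (td_H r gamma x w y - td_h p mu r gamma x w) i 0.
Proof.
move=> Yy; rewrite -nu_poisson// [RHS]mxE [X in _ = _ + X]mxE {1}/pn mem_set//.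
congr (_ - _); rewrite [RHS]mxE [RHS]Rintegral_mkcond /Rintegral; congr fine.
rewrite [RHS](_ : _ = \int[pair_kernel p y]_z (pn w z i 0)%:E)%E; last first.
  apply: eq_integral => z _; congr EFin; rewrite patchE /pn.
  by case: ifPn => // _; rewrite mxE.
rewrite /pair_kernel [RHS]integral_pushforward//.
  by apply/measurable_EFinP; case: (bpn w i).
apply: bmf_integrable; first exact: prob_kernel.
exact: bpn_slice.
Qed.

(** * The homogeneous system around a solution [wbar] *)

Section centered.
Variable wbar : 'cV[R]_n.
Hypothesis wbarP : td_solutions p mu r gamma x wbar.

Let A := td_A p mu gamma x.
Let A1 : 'M[R]_(n + 1) := block_mx A 0 0 0.

(* The Poisson solution for the homogeneous system satisfied by the column
   [(w - wbar, 1)]. *)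
Let V (y : T * T) : 'M[R]_(n + 1) :=
  block_mx (\matrix_(i, j) (pn (wbar + delta_mx j 0) y i 0 - pn wbar y i 0))
    (pn wbar y) 0 0.

Let bV i j : bmf (fun y => V y i j).
Proof.
rewrite /V; case: (split_ordP i) => i' ->; case: (split_ordP j) => j' ->.
- by under eq_fun do rewrite block_mxEul mxE; apply: bmfB; exact: bpn.
- by rewrite (ord1 j'); under eq_fun do rewrite block_mxEur; exact: bpn.
- by under eq_fun do rewrite block_mxEdl mxE; exact: bmf_cst.
- by under eq_fun do rewrite block_mxEdr mxE; exact: bmf_cst.
Qed.

(** The pair kernel applied to [V]. It depends only on the second state of the pair, which makes
    [VQ (X t)] known at time [t]. *)
Let VQ (s : T) : 'M[R]_(n + 1) := \matrix_(i, j) \int[p s]_s' V (s, s') i j.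

Let bVQ i j : bmf (fun s => VQ s i j).
Proof. by under eq_fun do rewrite mxE; exact: (bmf_kernel_int p (bV i j)). Qed.

(** As [td_H] is affine in [w], subtracting the Poisson equations at [wbar + delta_mx j 0] and
    [wbar] isolates column [j] of [td_rate - td_A]. The last column is the equation at [wbar], where
    [td_h] vanishes. *)
Let V_poisson y : Y y -> A1 + V y - VQ y.2 =
  block_mx (td_rate gamma x y) (td_H r gamma x wbar y) 0 0.
Proof.
move=> Yy; have p1 s : p s setT = 1%E by exact: prob_kernel.
have h0 : td_h p mu r gamma x wbar = 0.
  by rewrite (td_hE p mu gamma mr mx xM rM).
apply/matrixP => i j; rewrite [LHS]mxE [X in X + _]mxE [X in _ + X]mxE [X in _ - X]mxE.
rewrite /A1 /V; case: (split_ordP i) => i' ->; case: (split_ordP j) => j' ->.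
- rewrite !block_mxEul [X in _ + X - _]mxE.
  under eq_Rintegral do rewrite block_mxEul mxE.
  rewrite bmf_intB//.
  have e1 := pn_poisson (wbar + delta_mx j' 0) i' Yy.
  have e2 := pn_poisson wbar i' Yy.
  have alg (a b c q1 q2 : R) : c + (a - b) - (q1 - q2) = c + ((a - q1) - (b - q2)).
    by ring.
  rewrite alg e1 e2 !(td_hE p mu gamma mr mx xM rM) !td_HE -/A !mulmxDr -!colE.
  set a := td_rate gamma x y *m wbar; set b := A *m wbar.
  set bb := td_b _ _ _; set rx := r _ *: _.
  by rewrite !mxE; ring.
- rewrite !block_mxEur mxE add0r (ord1 j').
  under eq_Rintegral do rewrite block_mxEur.
  by rewrite pn_poisson// h0 subr0.
- rewrite !block_mxEdl !mxE add0r.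
  under eq_Rintegral do rewrite block_mxEdl mxE.
  by rewrite bmf_int_cst// subr0.
- rewrite !block_mxEdr !mxE add0r.
  under eq_Rintegral do rewrite block_mxEdr mxE.
  by rewrite bmf_int_cst// subr0.
Qed.

(** [M t] is [V] at the current pair minus its conditional mean; in [M t + N t - N t.+1] that mean
    cancels, leaving the combination of [V_poisson]. *)
Let M t omega := V (X t omega, X t.+1 omega) - VQ (X t omega).
Let N t omega := VQ (X t omega).

Let V_bnd : exists C, (forall y, `|V y| <= C) /\ (forall s, `|VQ s| <= C).
Proof.
have /choice[C HC] : forall ij : 'I_(n + 1) * 'I_(n + 1),
    exists C, forall y, `|V y ij.1 ij.2| <= C.
  by move=> [i j]; case: (bV i j).
have C0 ij : 0 <= C ij by apply: le_trans (HC ij point).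
pose D := \sum_ij C ij; have CD ij : C ij <= D.
  by rewrite /D (bigD1 ij)//= lerDl; apply: sumr_ge0.
have D0 : 0 <= D by apply: sumr_ge0.
exists D; split => [y|s].
  by apply: mx_norm_le => // i j; apply: le_trans (HC (i, j) y) (CD _).
apply: mx_norm_le => // i j; rewrite mxE; apply: bmf_int_norm.
- exact: prob_kernel.
- by apply: (bmf_comp (bV i j)); exact: pair1_measurable.
- by move=> s'; apply: le_trans (HC (i, j) _) (CD _).
Qed.

Let sX s t : (s <= t)%N -> smeas (history_gen X t) (X s).
Proof. exact: smeas_history. Qed.

Let N_adapted t i j : sbmf (history_gen X) t (fun w => N t w i j).
Proof. by apply: (bmf_comp (bVQ i j)); exact: (sX (leqnn t)). Qed.

Let M_mart i j : martingale_diff P (history_gen X) (fun t w => M t w i j).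
Proof.
split=> [t|t F sF].
  rewrite /M; under eq_fun do rewrite mxE [X in _ + X]mxE.
  apply: bmfB.
    apply: (bmf_comp (bV i j)); apply: measurable_fun_pair.
      exact: (sX (leqnSn t)).
    exact: (sX (leqnn t.+1)).
  by apply: (bmf_comp (bVQ i j)); exact: (sX (leqnSn t)).
rewrite /M; under eq_Rintegral do rewrite mxE [X in _ * (_ + X)]mxE [X in _ * (_ - X)]mxE.
apply: (@markov_expectation _ _ _ p _ _ P X t F (fun y => V y i j)) => //.
  exact: (sbmfW (@history_gen_measurable _ _ _ _ _ P X) sF).
by case: sF.
Qed.

Let A1_dissipative : exists2 c, 0 < c &
  forall z, c * sqnorm (A1 *m z) <= - dot z (A1 *m z).
Proof.
have [c c0 Hc] := td_A_dissipative mu_stat gamma01 mx xM.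
exists c => // z; rewrite -(vsubmxK z) /A1 mul_block_col !mul0mx !addr0.
set z1 := usubmx z; set z2 := dsubmx z.
have dotE1 (a b : 'cV[R]_n) (e : 'cV[R]_1) :
    dot (col_mx a e) (col_mx b 0) = dot a b.
  by rewrite /dot tr_col_mx mul_row_col mulmx0 addr0.
by rewrite sqnormE !dotE1 -sqnormE; exact: Hc.
Qed.

Let u0 : 'cV[R]_(n + 1) := col_mx (w0 - wbar) (const_mx 1).
Let u := sa_iter alpha A1 M N u0.
Let w omega := td_iter r gamma x alpha w0 (fun t => X t omega).

(** The zero bottom rows keep the last coordinate equal to 1, so the last column of the matrix
    supplies the inhomogeneous term [td_H] at [wbar]. *)
Let u_td omega : (forall t, Y (X t omega, X t.+1 omega)) ->
  forall t, u t omega = col_mx (w omega t - wbar) (const_mx 1).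
Proof.
move=> YX; elim=> // t IH.
rewrite /u /= -/(u t omega) IH /M /N.
have -> : A1 + (V (X t omega, X t.+1 omega) - VQ (X t omega)) + VQ (X t omega)
    - VQ (X t.+1 omega) = A1 + V (X t omega, X t.+1 omega) - VQ (X t.+1 omega).
  by rewrite addrA subrK.
rewrite (V_poisson (YX t)) mul_block_col !mul0mx addr0 scale_col_mx scaler0.
rewrite add_col_mx addr0; congr col_mx.
have -> : td_H r gamma x wbar (X t omega, X t.+1 omega) *m const_mx 1 =
    td_H r gamma x wbar (X t omega, X t.+1 omega).
  by apply/matrixP => i j; rewrite (ord1 j) mxE big_ord1 [X in _ * X]mxE mulr1.
have -> : td_rate gamma x (X t omega, X t.+1 omega) *m (w omega t - wbar)
    + td_H r gamma x wbar (X t omega, X t.+1 omega)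
    = td_H r gamma x (w omega t) (X t omega, X t.+1 omega).
  by rewrite !td_HE mulmxBr addrA subrK.
rewrite /w /= -/(w omega t) addrAC; congr (_ + _ - _).
by rewrite /td_H/= scalerA (dotC (x (X t.+1 omega))) (dotC (x (X t omega))).
Qed.

Lemma td_subsequence_centered : \forall omega \ae P,
  exists (tk : nat -> nat) (wstar : 'cV[R]_n),
    [/\ {homo tk : i j / (i < j)%N},
        (fun k => w omega (tk k)) @ \oo --> wstar,
        td_solutions p mu r gamma x wstar &
        forall L : R, 0 < L ->
          (fun k => \big[Num.max/0]_(tk k <= j < (horizon alpha (tk k) L).+1)
                      enorm (w omega j - wstar)) @ \oo --> (0 : R)].
Proof.
have [C [VC VQC]] := V_bnd; have [c c0 Hc] := A1_dissipative.
have C0 : 0 <= C by apply: le_trans (VC point).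
have MC t omega : `|M t omega| <= 2 * C.
  apply: le_trans (ler_normB _ _) _.
  have := lerD (VC (X t omega, X t.+1 omega)) (VQC (X t omega)).
  lra.
have NC t omega : `|N t omega| <= 2 * C.
  by apply: le_trans (VQC _) _; lra.
have nds : nondecreasing_seq (series (fun t => alpha t ^+ 2)).
  apply/nondecreasing_seqP => k; rewrite /series/= big_nat_recr//= lerDl.
  exact: sqr_ge0.
have aV k : \sum_(0 <= t < k) alpha t ^+ 2 <= limn (series (fun t => alpha t ^+ 2)).
  exact: nondecreasing_cvgn_le.
have GS t : history_gen X t `<=` history_gen X t.+1 by exact: history_gen_le.
have main := stochastic_approximation (@history_gen_measurable _ _ _ _ _ P X) GS
  alpha_gt0 alpha_decr alpha_sum aV c0 Hc MC NC N_adapted M_mart u0.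
apply: filterS2 main Y_chain => omega [sk [l [skS ul A1l win]]] YX.
have uE := u_td YX.
pose wstar := wbar + usubmx l.
have w_le j : `|w omega j - wstar| <= `|u j omega - l|.
  rewrite uE -(vsubmxK l) opp_col_mx add_col_mx /wstar opprD addrA.
  apply: mx_norm_le => // i k.
  by rewrite -(col_mxEu _ (const_mx 1 - dsubmx l)); exact: mx_entry_le_norm.
exists sk, wstar; split => //.
- apply/cvgrPdistC_le => e e0; move/cvgrPdistC_le : ul => /(_ e e0).
  by apply: filterS => k; apply: le_trans; exact: w_le.
- have Al : A *m usubmx l = 0.
    have := congr1 usubmx A1l.
    by rewrite -{1}(vsubmxK l) mul_block_col col_mxKu mul0mx addr0 linear0.
  move: wbarP; rewrite /td_solutions /= /wstar mulmxDr -/A Al addr0.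
  exact.
- move=> L L0; apply/cvgrPdist_le => e e0.
  (* The window estimate is in the sup norm; [enorm_le_norm] costs the factor [1 + n%:R]. *)
  have e1 : 0 < e / (1 + n%:R) by rewrite divr_gt0// ltr_pwDl.
  have := win L _ L0 e1; apply: filterS => k Hk.
  rewrite sub0r normrN ger0_norm; last exact: bigmax_ge_id.
  rewrite big_nat; apply: bigmax_le => [|j /andP[kj jh]]; first exact: ltW.
  have := Hk j kj (sum_le_horizon alpha_gt0 L0 kj jh).
  rewrite ler_pdivlMr ?ltr_pwDl// => H.
  apply: le_trans (enorm_le_norm _) _; rewrite mulrC; apply: le_trans H.
  by rewrite ler_wpM2r ?addr_ge0//; exact: w_le.
Qed.

End centered.

Theorem td_subsequence : \forall omega \ae P,
  let w := td_iter r gamma x alpha w0 (fun t => X t omega) in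
  exists (tk : nat -> nat) (wstar : 'cV[R]_n),
    [/\ {homo tk : i j / (i < j)%N},
        (fun k => w (tk k)) @ \oo --> wstar,
        td_solutions p mu r gamma x wstar &
        forall L : R, 0 < L ->
          (fun k => \big[Num.max/0]_(tk k <= j < (horizon alpha (tk k) L).+1)
                      enorm (w j - wstar)) @ \oo --> (0 : R)].
Proof.
have [wbar wbarP] := td_solution_exists mu_stat gamma01 mr mx xM rM.
exact: td_subsequence_centered wbarP.
Qed.

End td_convergence.

Theorem corollary19 (R : realType) (K d : nat)
    (S : set 'cV[R]_K) (S0 : S !=set0)
    (p : R.-pker (state S0) ~> (state S0))
    (dOmega : measure_display) (Omega : measurableType dOmega)
    (P : probability Omega R)
    (X : nat -> {RV P >-> state S0})
    (markovX : markov_chain p P X)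
    (r : state S0 -> R) (mr : measurable_fun setT r)
    (gamma : R) (gamma01 : 0 <= gamma < 1)
    (x : state S0 -> 'cV[R]_d) (mx : borel_fun setT x)
    (w0 : 'cV[R]_d)
    (alpha : nat -> R)
    (mu : probability (state S0) R)
    (Y : set (state S0 * state S0)) (mY : measurable Y)
    (Y_closed : forall y, Y y -> pair_kernel p y Y = 1%E)
    (Y_law : pair_law p mu Y = 1%E)
    (Y_chain : \forall omega \ae P, forall t, Y (X t omega, X t.+1 omega))
    (alpha_gt0 : forall t, 0 < alpha t)
    (alpha_decr : forall t, alpha t.+1 <= alpha t)
    (alpha_sum : series alpha @ \oo --> +oo)
    (alpha_sum2 : cvgn (series (fun t => alpha t ^+ 2)))
    (alpha_inv : cvgn (fun t => (alpha t.+1)^-1 - (alpha t)^-1))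
    (mu_stat : unique_stationary p mu)
    (mu_open : forall U : set (state S0), open U -> U !=set0 -> (0 < mu U)%E)
    (x_bnd : exists M : R, forall s, enorm (x s) <= M)
    (r_bnd : exists M : R, forall s, `|r s| <= M)
    (P_null : forall n (f : state S0 -> 'cV[R]_n), borel_fun setT f ->
      (\forall s \ae mu, f s = 0) -> \forall s \ae mu, kernel_app p f s = 0)
    (poisson : exists nu : 'cV[R]_d -> state S0 * state S0 -> 'cV[R]_d,
      [/\ forall w, borel_fun Y (nu w),
          forall w y, Y y ->
            nu w y - pair_kernel_app p Y (nu w) y
              = td_H r gamma x w y - td_h p mu r gamma x w &
          exists C : R, forall w w' y, Y y ->
            let ynorm := enorm (col_mx (val y.1) (val y.2)) in
            enorm (nu w y) <= C * (1 + enorm w) * (1 + ynorm) /\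
            enorm (pair_kernel_app p Y (nu w) y
                   - pair_kernel_app p Y (nu w') y)
              <= C * enorm (w - w') * (1 + ynorm)])
    (lil : forall w, exists zeta : Omega -> \bar R,
      [/\ measurable_fun setT zeta,
          \forall omega \ae P, zeta omega \is a fin_num &
          \forall omega \ae P, forall n : nat, (3 <= n)%N ->
            ((enorm (\sum_(1 <= t < n.+1)
                (td_H r gamma x w (X t omega, X t.+1 omega)
                 - td_h p mu r gamma x w)))%:E
             <= zeta omega * (Num.sqrt (n%:R * ln (ln n%:R)))%:E)%E])
    (S_compact : compact S) :
  \forall omega \ae P,
    let w := td_iter r gamma x alpha w0 (fun t => X t omega) in
    exists (tk : nat -> nat) (wstar : 'cV[R]_d),
      [/\ {homo tk : i j / (i < j)%N},
          (fun k => w (tk k)) @ \oo --> wstar,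
          td_solutions p mu r gamma x wstar &
          forall T : R, 0 < T ->
            (fun k => \big[Num.max/0]_(tk k <= j < (horizon alpha (tk k) T).+1)
                        enorm (w j - wstar)) @ \oo --> (0 : R)].
Proof.
have [Mx xM] := x_bnd; have [Mr rM] := r_bnd.
have [nu [mnu nuP [C nuC]]] := poisson.
(* Compactness turns the linear growth of [nu w] in the pair into a bound for each fixed [w]. *)
have [D DS] : exists D : R, forall s : state S0, `|val s| <= D.
  have [D [_ HD]] := compact_bounded S_compact.
  exists (D + 1) => s; apply: HD; first by rewrite ltrDl.
  exact: set_valP.
have D0 : 0 <= D by apply: le_trans (DS point).
(* A stacked pair has [K + K] entries, each at most [D] in absolute value. *)
pose E := 1 + (1 + (K + K)%:R) * D.
have nu_bnd w : exists C' : R, forall y, Y y -> `|nu w y| <= C'.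
  exists (`|C| * (1 + enorm w) * E) => y Yy.
  have [h _] := nuC w w y Yy.
  apply: le_trans (norm_le_enorm _) _; apply: le_trans h _.
  have yE : 1 + enorm (col_mx (val y.1) (val y.2)) <= E.
    rewrite lerD2l; apply: le_trans (enorm_le_norm _) _.
    rewrite ler_wpM2l ?addr_ge0//; apply: mx_norm_le => // i j.
    by case: (split_ordP i) => k ->; rewrite ?col_mxEu ?col_mxEd;
      apply: le_trans (mx_entry_le_norm _ _ _) (DS _).
  have y0 : 0 <= 1 + enorm (col_mx (val y.1) (val y.2)).
    by rewrite addr_ge0// sqrtr_ge0.
  have w1 : 0 <= 1 + enorm w by rewrite addr_ge0// sqrtr_ge0.
  apply: (@le_trans _ _ (`|C| * (1 + enorm w)
      * (1 + enorm (col_mx (val y.1) (val y.2))))).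
    by rewrite !ler_wpM2r// ler_norm.
  by rewrite ler_wpM2l// mulr_ge0.
exact: (td_subsequence markovX mu_stat.1 gamma01 mr mx xM rM w0 mY Y_chain
  alpha_gt0 alpha_decr alpha_sum alpha_sum2 mnu nuP nu_bnd).
Qed.
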